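(* Let $K$ be a large field. Let $X/K$ be a geometrically integral scheme of finite type of positive dimension with a smooth $K$-rational point. Let $L/K$ be a finite separable extension. Then $X/K$ has infinitely many new points over $L$.
   Context: A field $K$ is called large if every geometrically integral scheme of finite type $X/K$ with a $K$-rational smooth point is such that $X(K)$ is Zariski-dense in $X$. For a scheme $X$ of finite type over $K$ and a finite extension $L/K$, a point of $X(L)$ is new (one also calls it a new point over $L$) if it does not belong to $\bigcup_F X(F)$, where $F$ runs over all proper subfields $K\subseteq F\subset L$. *)

(* Defs.v *)
From HB Require Import structures.
From mathcomp Require Import all_boot all_order all_algebra all_field.
From mathcomp Require Import ring_quotient generic_quotient.
From mathcomp Require Import boolp classical_sets functions cardinality.
From mathcomp Require Import topology_structure.
From mathcomp Require Import ring.
From mathcomp Require mpoly.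
Import (canonicals) mpoly.

Set Implicit Arguments.
Unset Strict Implicit.
Unset Printing Implicit Defensive.

Import GRing.Theory.
Local Open Scope classical_set_scope.
Local Open Scope quotient_scope.
Local Open Scope ring_scope.

Record spec_pt (A : comNzRingType) := SpecPt {
  prime_pred : A -> bool;
  prime_ideal : idealr_closed prime_pred;
  prime_prime : prime_idealr_closed prime_pred
}.

Coercion prime_mem (A : comNzRingType) (p : spec_pt A) : {pred A} := prime_pred p.

HB.instance Definition _ (A : comNzRingType) (p : spec_pt A) :=
  isIdealr.Build A (prime_mem p) (prime_ideal p).
HB.instance Definition _ (A : comNzRingType) (p : spec_pt A) :=
  isPrimeIdealrClosed.Build A (prime_mem p) (@prime_prime A p).

Section Localization.
Variables (A : comNzRingType) (p : spec_pt A).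

Lemma prime_notin1 : 1 \notin p.
Proof. by rewrite idealr1. Qed.

Lemma prime_notinM (s t : A) : s \notin p -> t \notin p -> s * t \notin p.
Proof.
by move=> sp tp; rewrite prime_idealrM negb_or sp.
Qed.

Lemma prime_notinMl (s t : A) : s * t \notin p -> s \notin p.
Proof. by rewrite prime_idealrM negb_or => /andP[]. Qed.

Definition preloc := {x : A * A | x.2 \notin p}.

Definition loc_rel (x y : preloc) : bool :=
  `[< exists2 u, u \notin p &
      u * ((val x).1 * (val y).2 - (val y).1 * (val x).2) = 0 >].

Lemma loc_rel_refl : reflexive loc_rel.
Proof.
by move=> x; apply/asboolP; exists 1; rewrite ?prime_notin1 // subrr mulr0.
Qed.

Lemma loc_rel_sym : symmetric loc_rel.
Proof.
suff imp x y : loc_rel x y -> loc_rel y x by move=> x y; apply/idP/idP; exact: imp.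
move=> /asboolP[u up e]; apply/asboolP; exists u => //.
by apply: oppr_inj; rewrite oppr0 -e; ring.
Qed.

Lemma loc_rel_trans : transitive loc_rel.
Proof.
move=> [[b t] /= tp] [[a s] /= sp] [[c r] /= rp].
move=> /asboolP[/= u up e] /asboolP[/= v vp f]; apply/asboolP => /=.
exists (u * v * t); first by rewrite !prime_notinM.
transitivity (v * r * (u * (a * t - b * s)) + u * s * (v * (b * r - c * t))).
  by ring.
by rewrite e f; ring.
Qed.

Canonical loc_equiv := EquivRel loc_rel loc_rel_refl loc_rel_sym loc_rel_trans.

Definition loc := {eq_quot loc_rel}.
HB.instance Definition _ := EqQuotient.on loc.
HB.instance Definition _ := Choice.on loc.

Definition frac (a s : A) (sp : s \notin p) : loc := \pi_loc (exist _ (a, s) sp).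

Lemma frac_eq a s sp b t tp :
  @frac a s sp = @frac b t tp <-> exists2 u, u \notin p & u * (a * t - b * s) = 0.
Proof.
split=> [/eqmodP|e]; first by rewrite /= => /asboolP.
by apply/eqmodP; rewrite /=; apply/asboolP.
Qed.

Lemma frac_eq1 a s sp b t tp : a * t = b * s -> @frac a s sp = @frac b t tp.
Proof.
by move=> e; apply/frac_eq; exists 1; rewrite ?prime_notin1 // e subrr mulr0.
Qed.

Lemma locP (x : loc) : exists a s (sp : s \notin p), x = frac a sp.
Proof. by elim/quotW: x => -[[a s] sp]; exists a, s, sp. Qed.

Definition loc_num (x : loc) : A := (val (repr x)).1.
Definition loc_den (x : loc) : A := (val (repr x)).2.

Lemma loc_denP x : loc_den x \notin p.
Proof. exact: (valP (repr x)). Qed.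

Lemma loc_numden x : frac (loc_num x) (loc_denP x) = x.
Proof.
rewrite -[RHS]reprK /frac; congr (\pi_loc _); apply: val_inj => /=.
by rewrite /loc_num /loc_den -surjective_pairing.
Qed.

Lemma loc_repr a s sp :
  exists2 u, u \notin p & u * (loc_num (@frac a s sp) * s - a * loc_den (frac a sp)) = 0.
Proof. by apply/(@frac_eq _ _ (loc_denP _) _ _ sp); rewrite loc_numden. Qed.

Definition loc_add (x y : loc) : loc :=
  frac (loc_num x * loc_den y + loc_num y * loc_den x)
       (prime_notinM (loc_denP x) (loc_denP y)).
Definition loc_opp (x : loc) : loc := frac (- loc_num x) (loc_denP x).
Definition loc_mul (x y : loc) : loc :=
  frac (loc_num x * loc_num y) (prime_notinM (loc_denP x) (loc_denP y)).

Lemma loc_addE a s sp b t tp :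
  loc_add (@frac a s sp) (@frac b t tp) = frac (a * t + b * s) (prime_notinM sp tp).
Proof.
have [u up e] := loc_repr a sp; have [v vp f] := loc_repr b tp.
apply/frac_eq; exists (u * v); first exact: prime_notinM.
move: (loc_num (frac a sp)) (loc_den (frac a sp)) e => a' s' e.
move: (loc_num (frac b tp)) (loc_den (frac b tp)) f => b' t' f.
transitivity (v * t * t' * (u * (a' * s - a * s')) + u * s * s' * (v * (b' * t - b * t'))).
  by ring.
by rewrite e f; ring.
Qed.

Lemma loc_oppE a s sp : loc_opp (@frac a s sp) = frac (- a) sp.
Proof.
have [u up e] := loc_repr a sp; apply/frac_eq; exists u => //.
by apply: oppr_inj; rewrite oppr0 -e; ring.
Qed.

Lemma loc_mulE a s sp b t tp :
  loc_mul (@frac a s sp) (@frac b t tp) = frac (a * b) (prime_notinM sp tp).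
Proof.
have [u up e] := loc_repr a sp; have [v vp f] := loc_repr b tp.
apply/frac_eq; exists (u * v); first exact: prime_notinM.
move: (loc_num (frac a sp)) (loc_den (frac a sp)) e => a' s' e.
move: (loc_num (frac b tp)) (loc_den (frac b tp)) f => b' t' f.
transitivity (v * b' * t * (u * (a' * s - a * s')) + u * a * s' * (v * (b' * t - b * t'))).
  by ring.
by rewrite e f; ring.
Qed.

Lemma loc_addA : associative loc_add.
Proof.
move=> x y z; have [a [r [rp ->]]] := locP x; have [b [s [sp ->]]] := locP y.
by have [c [t [tp ->]]] := locP z; rewrite !loc_addE; apply: frac_eq1; ring.
Qed.

Lemma loc_addC : commutative loc_add.
Proof.
move=> x y; have [a [r [rp ->]]] := locP x; have [b [s [sp ->]]] := locP y.
by rewrite !loc_addE; apply: frac_eq1; ring.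
Qed.

Lemma loc_add0 : left_id (frac 0 prime_notin1) loc_add.
Proof.
by move=> x; have [a [r [rp ->]]] := locP x; rewrite loc_addE; apply: frac_eq1; ring.
Qed.

Lemma loc_addN : left_inverse (frac 0 prime_notin1) loc_opp loc_add.
Proof.
move=> x; have [a [r [rp ->]]] := locP x.
by rewrite loc_oppE loc_addE; apply: frac_eq1; ring.
Qed.

HB.instance Definition _ :=
  GRing.isZmodule.Build loc loc_addA loc_addC loc_add0 loc_addN.

Lemma loc_mulA : associative loc_mul.
Proof.
move=> x y z; have [a [r [rp ->]]] := locP x; have [b [s [sp ->]]] := locP y.
by have [c [t [tp ->]]] := locP z; rewrite !loc_mulE; apply: frac_eq1; ring.
Qed.

Lemma loc_mulC : commutative loc_mul.
Proof.
move=> x y; have [a [r [rp ->]]] := locP x; have [b [s [sp ->]]] := locP y.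
by rewrite !loc_mulE; apply: frac_eq1; ring.
Qed.

Lemma loc_mul1 : left_id (frac 1 prime_notin1) loc_mul.
Proof.
by move=> x; have [a [r [rp ->]]] := locP x; rewrite loc_mulE; apply: frac_eq1; ring.
Qed.

Lemma loc_mulDl : left_distributive loc_mul loc_add.
Proof.
move=> x y z; have [a [r [rp ->]]] := locP x; have [b [s [sp ->]]] := locP y.
have [c [t [tp ->]]] := locP z.
by rewrite loc_addE !loc_mulE loc_addE; apply: frac_eq1; ring.
Qed.

Lemma loc_nonzero1 : frac 1 prime_notin1 <> 0.
Proof.
move=> /frac_eq[u up]; rewrite mulr1 mul0r subr0 mulr1 => u0.
by move: up; rewrite u0 rpred0.
Qed.

HB.instance Definition _ := GRing.Zmodule_isComNzRing.Build loc
  loc_mulA loc_mulC loc_mul1 loc_mulDl (introN eqP loc_nonzero1).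

Lemma fracD a s sp b t tp :
  @frac a s sp + @frac b t tp = frac (a * t + b * s) (prime_notinM sp tp).
Proof. exact: loc_addE. Qed.

Lemma fracN a s sp : - @frac a s sp = frac (- a) sp.
Proof. exact: loc_oppE. Qed.

Lemma fracM a s sp b t tp :
  @frac a s sp * @frac b t tp = frac (a * b) (prime_notinM sp tp).
Proof. exact: loc_mulE. Qed.

Lemma frac0 : 0 = frac 0 prime_notin1 :> loc. Proof. by []. Qed.
Lemma frac1 : 1 = frac 1 prime_notin1 :> loc. Proof. by []. Qed.

End Localization.

Set Primitive Projections.
Record opens (T : topologicalType) :=
  Opens { oset :> set T; oset_open : open oset }.
Unset Primitive Projections.

(* [sections U] may be the zero ring, e.g. for the empty open set. *)
Record ringed_space := RingedSpace {
  space :> topologicalType;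
  sections : opens space -> comPzRingType;
  res : forall U V : opens space, V `<=` U -> {rmorphism sections U -> sections V};
  res_id : forall (U : opens space) (UU : U `<=` U) (s : sections U), res UU s = s;
  res_res : forall (U V W : opens space) (VU : V `<=` U) (WV : W `<=` V)
      (WU : W `<=` U) (s : sections U),
    res WV (res VU s) = res WU s;
  sheaf_separated : forall (U : opens space) (I : Type) (V : I -> opens space)
      (VU : forall i, V i `<=` U),
    U `<=` \bigcup_i V i ->
    forall s t : sections U, (forall i, res (VU i) s = res (VU i) t) -> s = t;
  sheaf_glue : forall (U : opens space) (I : Type) (V : I -> opens space)
      (VU : forall i, V i `<=` U),
    U `<=` \bigcup_i V i ->
    forall s : (forall i, sections (V i)),
    (forall i j (W : opens space) (Wi : W `<=` V i) (Wj : W `<=` V j),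
      res Wi (s i) = res Wj (s j)) ->
    exists t : sections U, forall i, res (VU i) t = s i
}.

Arguments sections X U : clear implicits, rename.
Arguments res {X U V} VU : rename.

(* The germ of [s] at [x] is a unit of the stalk at [x]. *)
Definition germ_unit (X : ringed_space) (U : opens X) (s : sections X U) (x : X) :=
  exists (V : opens X) (VU : V `<=` U), oset V x /\
    exists t : sections X V, res VU s * t = 1.

Definition opens_preim (T S : topologicalType) (f : T -> S)
    (cf : forall U : set S, open U -> open (f @^-1` U)) (U : opens S) : opens T :=
  Opens (cf U (oset_open U)).

(* Morphisms of locally ringed spaces: the last field says that the maps
   induced on stalks are local homomorphisms. *)
Record rs_hom (X Y : ringed_space) := RsHom {
  hom_fun :> X -> Y;
  hom_open : forall U : set Y, open U -> open (hom_fun @^-1` U);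
  hom_sec : forall U : opens Y,
    {rmorphism sections Y U -> sections X (opens_preim hom_open U)};
  hom_res : forall (U V : opens Y) (VU : V `<=` U)
      (VU' : opens_preim hom_open V `<=` opens_preim hom_open U)
      (s : sections Y U),
    res VU' (hom_sec U s) = hom_sec V (res VU s);
  hom_local : forall (U : opens Y) (s : sections Y U) (x : X),
    oset U (hom_fun x) -> germ_unit (hom_sec U s) x -> germ_unit s (hom_fun x)
}.

Definition hom_preim (X Y : ringed_space) (f : rs_hom X Y) (U : opens Y) : opens X :=
  opens_preim (hom_open f) U.

Section Composition.
Variables (X Y Z : ringed_space) (g : rs_hom Y Z) (f : rs_hom X Y).

Definition comp_open (U : set Z) (oU : open U) : open ((g \o f) @^-1` U) :=
  hom_open f (hom_open g oU).

Definition comp_sec (U : opens Z) :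
    {rmorphism sections Z U -> sections X (opens_preim comp_open U)} :=
  (hom_sec f (hom_preim g U) \o hom_sec g U : {rmorphism _ -> _}).

Lemma comp_res (U V : opens Z) (VU : V `<=` U)
    (VU' : opens_preim comp_open V `<=` opens_preim comp_open U)
    (s : sections Z U) :
  res VU' (comp_sec U s) = comp_sec V (res VU s).
Proof.
have VU1 : hom_preim g V `<=` hom_preim g U by move=> y; exact: VU.
by rewrite /= -(hom_res (r := g) VU VU1) -(hom_res (r := f) VU1 VU').
Qed.

Lemma comp_local (U : opens Z) (s : sections Z U) (x : X) :
  oset U ((g \o f) x) -> germ_unit (comp_sec U s) x -> germ_unit s ((g \o f) x).
Proof.
move=> Ux us; apply: (hom_local (r := g)) => //.
exact: (hom_local (r := f) (U := hom_preim g U)).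
Qed.

Definition rs_comp : rs_hom X Z := RsHom comp_res comp_local.

End Composition.

Section Identity.
Variable X : ringed_space.

Definition id_open (U : set X) (oU : open U) : open (idfun @^-1` U) := oU.

(* [opens] has definitional eta, so [opens_preim id_open U] is convertible to [U]. *)
Definition id_sec (U : opens X) :
    {rmorphism sections X U -> sections X (opens_preim id_open U)} :=
  (idfun : {rmorphism sections X U -> sections X U}).

Lemma id_res (U V : opens X) (VU : V `<=` U)
    (VU' : opens_preim id_open V `<=` opens_preim id_open U)
    (s : sections X U) : res VU' (id_sec U s) = id_sec V (res VU s).
Proof. by rewrite /= (Prop_irrelevance VU' VU). Qed.

Lemma id_local (U : opens X) (s : sections X U) (x : X) :
  oset U (idfun x) -> germ_unit (id_sec U s) x -> germ_unit s (idfun x).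
Proof. by []. Qed.

Definition rs_id : rs_hom X X := RsHom id_res id_local.

End Identity.

(* Isomorphism onto an open ringed subspace of [X]. *)
Record open_immersion (Y X : ringed_space) (j : rs_hom Y X) : Prop := OpenImmersion {
  oimm_inj : injective j;
  oimm_open : forall V : set Y, open V -> open (j @` V);
  oimm_sec : forall U : opens X, U `<=` range j -> bijective (hom_sec j U)
}.

Section SpecTopology.
Variable A : comNzRingType.

HB.instance Definition _ := gen_eqMixin (spec_pt A).
HB.instance Definition _ := gen_choiceMixin (spec_pt A).

Definition primes_outside (S : set A) : set (spec_pt A) :=
  [set p : spec_pt A | exists2 f, S f & f \notin p].

Definition zariski_open : set (set (spec_pt A)) := range primes_outside.

Lemma zariski_openT : zariski_open setT.
Proof.
exists setT => //; apply/seteqP; split=> // p _; exists 1 => //.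
by rewrite idealr1.
Qed.

Lemma zariski_openI : setI_closed zariski_open.
Proof.
move=> _ _ [S _ <-] [T _ <-].
exists [set x | exists f g, [/\ S f, T g & x = f * g]] => //.
apply/seteqP; split=> p.
  move=> [_ [f [g [Sf Tg ->]]] fgp]; split.
    by exists f => //; exact: prime_notinMl fgp.
  by exists g => //; move: fgp; rewrite mulrC; exact: prime_notinMl.
move=> [[f Sf fp] [g Tg gp]]; exists (f * g); first by exists f, g.
exact: prime_notinM.
Qed.

Lemma zariski_open_bigU (I : Type) (F : I -> set (spec_pt A)) :
  (forall i, zariski_open (F i)) -> zariski_open (\bigcup_i F i).
Proof.
move=> Fo.
have {Fo}Fo i : exists S, primes_outside S = F i by have [S _ <-] := Fo i; exists S.
have [S SF] := choice Fo; exists (\bigcup_i S i) => //; apply/seteqP; split=> p.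
  by move=> [f [i _ Sif] fp]; exists i => //; rewrite -SF; exists f.
move=> [i _ Fip]; move: Fip; rewrite -SF.
by move=> [f Sif fp]; exists f => //; exists i.
Qed.

HB.instance Definition _ := isOpenTopological.Build (spec_pt A)
  zariski_openT zariski_openI zariski_open_bigU.

End SpecTopology.

Section StructureSheaf.
Variable A : comNzRingType.
Implicit Types U V W : opens (spec_pt A).

Definition germs U := forall p : {p : spec_pt A | oset U p}, loc (sval p).

Definition locally_frac U (s : germs U) :=
  forall p, oset U p -> exists V : opens (spec_pt A), oset V p /\
    exists a f : A, forall q (Uq : oset U q), oset V q ->
      exists fq : f \notin q, s (exist _ q Uq) = frac a fq.

Lemma germs_irrelevance U (s : germs U) p (Up Up' : oset U p) :
  s (exist _ p Up) = s (exist _ p Up').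
Proof. by rewrite (Prop_irrelevance Up Up'). Qed.

Record spec_section U := SpecSection {
  germ_of :> forall p : {p : spec_pt A | oset U p}, loc (sval p);
  germ_ofP : locally_frac germ_of
}.

Lemma spec_sectionP U (s t : spec_section U) : (forall p, s p = t p) -> s = t.
Proof.
case: s t => [s sP] [t tP] /= st.
have e : s = t by apply: functional_extensionality_dep.
by case: _ / e in tP *; congr SpecSection; exact: Prop_irrelevance.
Qed.

HB.instance Definition _ U := gen_eqMixin (spec_section U).
HB.instance Definition _ U := gen_choiceMixin (spec_section U).

Lemma opens_inter V W : open (V `&` W).
Proof. by apply: openI; exact: oset_open. Qed.

Section Ring.
Variable U : opens (spec_pt A).
Implicit Types s t : spec_section U.

Lemma locally_frac_cst (a : A) :
  @locally_frac U (fun p => frac a (prime_notin1 (sval p))).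
Proof.
move=> p Up; exists U; split=> //; exists a, 1 => q Uq _.
by exists (prime_notin1 q).
Qed.

Lemma locally_fracN s : @locally_frac U (fun p => - s p).
Proof.
move=> p /(@germ_ofP _ s)[V [Vp [a [f sV]]]]; exists V; split=> //.
by exists (- a), f => q Uq /(sV _ Uq)[fq ->]; exists fq; rewrite fracN.
Qed.

Lemma locally_fracD s t : @locally_frac U (fun p => s p + t p).
Proof.
move=> p Up; have [V [Vp [a [f sV]]]] := germ_ofP s Up.
have [W [Wp [b [g tW]]]] := germ_ofP t Up.
exists (Opens (opens_inter V W)); split=> //.
exists (a * g + b * f), (f * g) => q Uq [/(sV _ Uq)[fq ->] /(tW _ Uq)[gq ->]].
by exists (prime_notinM fq gq); rewrite fracD.
Qed.

Lemma locally_fracM s t : @locally_frac U (fun p => s p * t p).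
Proof.
move=> p Up; have [V [Vp [a [f sV]]]] := germ_ofP s Up.
have [W [Wp [b [g tW]]]] := germ_ofP t Up.
exists (Opens (opens_inter V W)); split=> //.
exists (a * b), (f * g) => q Uq [/(sV _ Uq)[fq ->] /(tW _ Uq)[gq ->]].
by exists (prime_notinM fq gq); rewrite fracM.
Qed.

Definition section_cst a := SpecSection (locally_frac_cst a).
Definition section_opp s := SpecSection (locally_fracN s).
Definition section_add s t := SpecSection (locally_fracD s t).
Definition section_mul s t := SpecSection (locally_fracM s t).

Fact section_addA : associative section_add.
Proof. by move=> r s t; apply: spec_sectionP => p /=; rewrite addrA. Qed.
Fact section_addC : commutative section_add.
Proof. by move=> s t; apply: spec_sectionP => p /=; rewrite addrC. Qed.
Fact section_add0 : left_id (section_cst 0) section_add.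
Proof. by move=> s; apply: spec_sectionP => p /=; rewrite -frac0 add0r. Qed.
Fact section_addN : left_inverse (section_cst 0) section_opp section_add.
Proof. by move=> s; apply: spec_sectionP => p /=; rewrite -frac0 addNr. Qed.

HB.instance Definition _ := GRing.isZmodule.Build (spec_section U)
  section_addA section_addC section_add0 section_addN.

Fact section_mulA : associative section_mul.
Proof. by move=> r s t; apply: spec_sectionP => p /=; rewrite mulrA. Qed.
Fact section_mulC : commutative section_mul.
Proof. by move=> s t; apply: spec_sectionP => p /=; rewrite mulrC. Qed.
Fact section_mul1 : left_id (section_cst 1) section_mul.
Proof. by move=> s; apply: spec_sectionP => p /=; rewrite -frac1 mul1r. Qed.
Fact section_mulDl : left_distributive section_mul section_add.
Proof. by move=> r s t; apply: spec_sectionP => p /=; rewrite mulrDl. Qed.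

HB.instance Definition _ := GRing.Zmodule_isComPzRing.Build (spec_section U)
  section_mulA section_mulC section_mul1 section_mulDl.

End Ring.

Section Restriction.
Variables (U V : opens (spec_pt A)) (VU : V `<=` U).

Definition restrict_germs (s : germs U) : germs V :=
  fun p => s (exist _ (sval p) (VU (proj2_sig p))).

Lemma restrict_frac (s : spec_section U) : locally_frac (restrict_germs s).
Proof.
move=> p Vp; have [W [Wp [a [f sW]]]] := germ_ofP s (VU Vp).
by exists W; split=> //; exists a, f => q Vq; exact: sW.
Qed.

Definition spec_restrict (s : spec_section U) := SpecSection (restrict_frac s).

Fact spec_restrict_zmod : zmod_morphism spec_restrict.
Proof. by move=> s t; apply: spec_sectionP. Qed.
Fact spec_restrict_monoid : monoid_morphism spec_restrict.
Proof. by split=> [|s t]; apply: spec_sectionP. Qed.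

HB.instance Definition _ := GRing.isZmodMorphism.Build
  (spec_section U) (spec_section V) spec_restrict spec_restrict_zmod.
HB.instance Definition _ := GRing.isMonoidMorphism.Build
  (spec_section U) (spec_section V) spec_restrict spec_restrict_monoid.

End Restriction.

Lemma spec_res_id U (UU : U `<=` U) (s : spec_section U) : spec_restrict UU s = s.
Proof.
apply: spec_sectionP => -[p Up] /=; rewrite /restrict_germs /=.
exact: germs_irrelevance.
Qed.

Lemma spec_res_res U V W (VU : V `<=` U) (WV : W `<=` V) (WU : W `<=` U)
  (s : spec_section U) : spec_restrict WV (spec_restrict VU s) = spec_restrict WU s.
Proof.
apply: spec_sectionP => -[p Wp]; rewrite /= /restrict_germs /=.
exact: germs_irrelevance.
Qed.

Lemma spec_separated U (I : Type) (V : I -> opens (spec_pt A))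
    (VU : forall i, V i `<=` U) : U `<=` \bigcup_i V i ->
  forall s t : spec_section U,
  (forall i, spec_restrict (VU i) s = spec_restrict (VU i) t) -> s = t.
Proof.
move=> cov s t st; apply: spec_sectionP => -[p Up].
have [i _ Vip] := cov p Up.
have := congr1 (fun r : spec_section (V i) => r (exist _ p Vip)) (st i).
rewrite /= /restrict_germs /= => e.
apply: (etrans (germs_irrelevance s Up (VU i p Vip))).
by apply: (etrans e); exact: germs_irrelevance.
Qed.

Lemma spec_glue U (I : Type) (V : I -> opens (spec_pt A))
    (VU : forall i, V i `<=` U) : U `<=` \bigcup_i V i ->
  forall s : (forall i, spec_section (V i)),
  (forall i j W (Wi : W `<=` V i) (Wj : W `<=` V j),
    spec_restrict Wi (s i) = spec_restrict Wj (s j)) ->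
  exists t : spec_section U, forall i, spec_restrict (VU i) t = s i.
Proof.
move=> cov s compat.
have ex (p : {p : spec_pt A | oset U p}) : exists i, oset (V i) (sval p).
  by have [i _ Vi] := cov _ (proj2_sig p); exists i.
pose idx p := sval (cid (ex p)).
pose t0 : germs U := fun p => s (idx p) (exist _ (sval p) (proj2_sig (cid (ex p)))).
have t0E i p (Up : oset U p) (Vp : oset (V i) p) : t0 (exist _ p Up) = s i (exist _ p Vp).
  rewrite /t0 /=; set j := idx _; set Vj := proj2_sig _.
  have W1 : V j `&` V i `<=` V j by move=> q [].
  have W2 : V j `&` V i `<=` V i by move=> q [].
  pose W := Opens (opens_inter (V j) (V i)); pose Wp : oset W p := conj Vj Vp.
  have := congr1 (fun r : spec_section W => r (exist _ p Wp)) (compat j i W W1 W2).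
  rewrite /= /restrict_germs /= => e.
  apply: (etrans (germs_irrelevance (s j) Vj (W1 _ Wp))).
  by apply: (etrans e); exact: germs_irrelevance.
have t0P : locally_frac t0.
  move=> p Up; have [i _ Vip] := cov p Up.
  have [W [Wp [a [f sW]]]] := germ_ofP (s i) Vip.
  exists (Opens (opens_inter (V i) W)); split=> //.
  exists a, f => q Uq [Vq Wq]; have [fq e] := sW q Vq Wq.
  by exists fq; rewrite (t0E i q Uq Vq).
exists (SpecSection t0P) => i; apply: spec_sectionP => -[p Vp].
exact: t0E.
Qed.

Definition Spec : ringed_space :=
  RingedSpace spec_res_id spec_res_res spec_separated spec_glue.

End StructureSheaf.

Section SpecMap.
Variables (A B : comNzRingType) (phi : {rmorphism A -> B}).

Section Contraction.
Variable q : spec_pt B.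

Definition preim_ideal : A -> bool := fun a => phi a \in q.

Lemma in_preim_ideal a : (a \in preim_ideal) = (phi a \in q).
Proof. by []. Qed.

Fact preim_ideal_idealr : idealr_closed preim_ideal.
Proof.
split=> [||a u v]; rewrite !in_preim_ideal.
- by rewrite rmorph0 rpred0.
- by rewrite rmorph1 idealr1.
- by rewrite rmorphD rmorphM => uq vq; rewrite rpredD //; exact: idealMr.
Qed.

Fact preim_ideal_prime : prime_idealr_closed preim_ideal.
Proof. by move=> u v; rewrite !in_preim_ideal rmorphM prime_idealrM. Qed.

Definition spec_fun : spec_pt A := SpecPt preim_ideal_idealr preim_ideal_prime.

Lemma preim_ideal_notin (s : A) : s \notin spec_fun -> phi s \notin q.
Proof. by []. Qed.

Definition loc_map (x : loc spec_fun) : loc q :=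
  frac (phi (loc_num x)) (preim_ideal_notin (loc_denP x)).

Lemma loc_mapE a s (sp : s \notin spec_fun) :
  loc_map (frac a sp) = frac (phi a) (preim_ideal_notin sp).
Proof.
have [u up e] := loc_repr a sp; apply/frac_eq; exists (phi u) => //.
by rewrite -!rmorphM -rmorphB -rmorphM e rmorph0.
Qed.

Fact loc_map_zmod : zmod_morphism loc_map.
Proof.
move=> x y; have [a [r [rp ->]]] := locP x; have [b [s [sp ->]]] := locP y.
rewrite fracN fracD !loc_mapE fracN fracD; apply: frac_eq1.
by rewrite rmorphD !rmorphM rmorphN.
Qed.

Fact loc_map_monoid : monoid_morphism loc_map.
Proof.
split=> [|x y].
  by rewrite frac1 loc_mapE; apply: frac_eq1; rewrite rmorph1.
have [a [r [rp ->]]] := locP x; have [b [s [sp ->]]] := locP y.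
by rewrite fracM !loc_mapE fracM; apply: frac_eq1; rewrite !rmorphM.
Qed.

HB.instance Definition _ :=
  GRing.isZmodMorphism.Build (loc spec_fun) (loc q) loc_map loc_map_zmod.
HB.instance Definition _ :=
  GRing.isMonoidMorphism.Build (loc spec_fun) (loc q) loc_map loc_map_monoid.

End Contraction.

Lemma spec_fun_open (U : set (spec_pt A)) :
  open U -> open ((spec_fun : spec_pt B -> spec_pt A) @^-1` U).
Proof.
move=> [S _ <-]; exists (phi @` S) => //; apply/seteqP; split=> q.
  by move=> [_ [f Sf <-] fq]; exists f.
by move=> [f Sf fq]; exists (phi f) => //; exists f.
Qed.

Local Notation preim U := (opens_preim spec_fun_open U).

Section Sections.
Variable U : opens (spec_pt A).

Definition spec_pull_germs (s : germs U) : germs (preim U) :=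
  fun q => loc_map (s (exist _ (spec_fun (sval q)) (proj2_sig q))).

Lemma spec_pull_frac (s : spec_section U) : locally_frac (spec_pull_germs s).
Proof.
move=> q Uq; have [V [Vq [a [f sV]]]] := germ_ofP s Uq.
exists (preim V); split=> //; exists (phi a), (phi f) => r Ur Vr.
have [fr e] := sV _ Ur Vr; exists (preim_ideal_notin fr).
by rewrite /spec_pull_germs /= e loc_mapE.
Qed.

Definition spec_pull (s : spec_section U) := SpecSection (spec_pull_frac s).

Fact spec_pull_zmod : zmod_morphism spec_pull.
Proof. by move=> s t; apply: spec_sectionP => q; rewrite /= /spec_pull_germs rmorphB. Qed.

Fact spec_pull_monoid : monoid_morphism spec_pull.
Proof.
split=> [|s t]; apply: spec_sectionP => q; rewrite /= /spec_pull_germs.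
  exact: (rmorph1 (@loc_map (sval q))).
by rewrite rmorphM.
Qed.

HB.instance Definition _ := GRing.isZmodMorphism.Build
  (spec_section U) (spec_section (preim U)) spec_pull spec_pull_zmod.
HB.instance Definition _ := GRing.isMonoidMorphism.Build
  (spec_section U) (spec_section (preim U)) spec_pull spec_pull_monoid.

End Sections.

Lemma spec_pull_res (U V : opens (spec_pt A)) (VU : V `<=` U)
    (VU' : preim V `<=` preim U) (s : spec_section U) :
  spec_restrict VU' (spec_pull s) = spec_pull (spec_restrict VU s).
Proof.
apply: spec_sectionP => -[q Vq]; rewrite /= /restrict_germs /spec_pull_germs /=.
by congr loc_map; exact: germs_irrelevance.
Qed.

Lemma spec_pull_local (U : opens (Spec A)) (s : sections (Spec A) U) (q : Spec B) :
  oset U (spec_fun q) ->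
  germ_unit (X := Spec B) (U := preim U) (spec_pull s) q ->
  germ_unit s (spec_fun q).
Proof.
move=> Uq [V [VU [Vq [t st1]]]].
have [W [Wq [a [f sW]]]] := germ_ofP s Uq.
have aq : a \notin spec_fun q.
  have := congr1 (fun r : spec_section V => r (exist _ q Vq)) st1.
  rewrite /= /restrict_germs /spec_pull_germs /=.
  rewrite (germs_irrelevance s _ Uq); have [fq ->] := sW _ Uq Wq.
  have [b [g [gq ->]]] := locP (t (exist _ q Vq)).
  rewrite loc_mapE fracM => /frac_eq[u uq]; rewrite mulr1 mul1r => e.
  apply: contraL uq => aq; apply/negPn.
  have : u * (phi f * g) \in q.
    have -> : u * (phi f * g) = u * b * phi a.
      by move/eqP: e; rewrite mulrBr subr_eq0 => /eqP <-; ring.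
    exact: idealMr.
  rewrite !prime_idealrM => /orP[//|/orP[fq'|gq']].
    by move: (preim_ideal_notin fq); rewrite fq'.
  by move: gq; rewrite gq'.
have oD : open (primes_outside [set a]) by exists [set a].
have oV' : open (oset U `&` oset W `&` primes_outside [set a]).
  by do 2?[apply: openI => //]; exact: oset_open.
pose V' := Opens oV'.
have V'U : V' `<=` U by move=> p [[]].
have aV' (p : {p : spec_pt A | oset V' p}) : a \notin sval p.
  by have [_ [b ba bp]] := proj2_sig p; rewrite -(ba : b = a).
pose t' : germs V' := fun p => frac f (aV' p).
have t'P : locally_frac t'.
  move=> p V'p; exists V'; split=> //; exists f, a => r V'r _.
  by exists (aV' (exist _ r V'r)).
exists V', V'U; split; first by split=> //; exists a.
exists (SpecSection t'P); apply: spec_sectionP => -[p V'p].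
rewrite /= /restrict_germs /= /t'; have [[Up Wp] _] := V'p.
rewrite (germs_irrelevance s _ Up); have [fp ->] := sW _ Up Wp.
by rewrite fracM; apply: frac_eq1; ring.
Qed.

Definition Spec_map : rs_hom (Spec B) (Spec A) :=
  @RsHom (Spec B) (Spec A) spec_fun spec_fun_open spec_pull spec_pull_res spec_pull_local.

End SpecMap.

(* The locality condition in [rs_hom] is automatic for an open immersion, so a
   scheme is a ringed space that is locally isomorphic to spectra. *)
Record scheme := Scheme {
  underlying :> ringed_space;
  locally_affine : forall x : underlying,
    exists (A : comNzRingType) (j : rs_hom (Spec A) underlying),
      open_immersion j /\ range j x
}.

Lemma Spec_locally_affine (A : comNzRingType) (x : Spec A) :
  exists (B : comNzRingType) (j : rs_hom (Spec B) (Spec A)),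
    open_immersion j /\ range j x.
Proof.
exists A, (rs_id (Spec A)); split; last by exists x.
split=> [//|V|U _]; first by rewrite image_id.
by exists idfun.
Qed.

Definition affine_scheme (A : comNzRingType) : scheme :=
  Scheme (@Spec_locally_affine A).

Definition is_fibre_product (X Y Z P : scheme) (f : rs_hom X Z) (g : rs_hom Y Z)
    (p : rs_hom P X) (q : rs_hom P Y) : Prop :=
  rs_comp f p = rs_comp g q /\
  forall (T : scheme) (a : rs_hom T X) (b : rs_hom T Y), rs_comp f a = rs_comp g b ->
    exists! u : rs_hom T P, rs_comp p u = a /\ rs_comp q u = b.

Definition integral_scheme (X : scheme) : Prop :=
  (exists x : X, True) /\
  forall U : opens X, U !=set0 ->
    (1 : sections X U) <> 0 /\
    forall s t : sections X U, s * t = 0 -> s = 0 \/ t = 0.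

Definition irreducible_closed (T : topologicalType) (Z : set T) : Prop :=
  [/\ closed Z, Z !=set0 &
      forall C D : set T, closed C -> closed D ->
        Z `<=` C `|` D -> Z `<=` C \/ Z `<=` D].

(* The Krull dimension of [T] is at least [n]: there is a chain of [n.+1]
   irreducible closed subsets. *)
Definition dim_ge (T : topologicalType) (n : nat) : Prop :=
  exists Z : 'I_n.+1 -> set T,
    (forall i, irreducible_closed (Z i)) /\
    (forall i j : 'I_n.+1, (i < j)%N -> Z i `<` Z j).

Record scheme_over (K : fieldType) := SchemeOver {
  total_scheme :> scheme;
  structure_map : rs_hom total_scheme (Spec K)
}.

(* X(A), for a K-algebra A given by its structure map [iota]. *)
Definition points (K : fieldType) (X : scheme_over K) (A : comNzRingType)
    (iota : {rmorphism K -> A}) : set (rs_hom (Spec A) X) :=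
  [set h | rs_comp (structure_map X) h = Spec_map iota].
Arguments points {K} X {A} iota.

(* The images of the elements of X(K) in the underlying space of X. *)
Definition rational_points (K : fieldType) (X : scheme_over K) : set X :=
  \bigcup_(h in points X (idfun : {rmorphism K -> K})) range h.
Arguments rational_points {K} X.

Definition geometrically_integral (K : fieldType) (X : scheme_over K) : Prop :=
  forall (K' : fieldType) (iota : {rmorphism K -> K'}) (Y : scheme)
    (p : rs_hom Y X) (q : rs_hom Y (affine_scheme K')),
    @is_fibre_product X (affine_scheme K') (affine_scheme K) Y
      (structure_map X) (Spec_map iota) p q ->
    integral_scheme Y.

(* Affine open subschemes of X, with their induced structure of K-scheme. *)
Record chart (K : fieldType) (X : scheme_over K) := Chart {
  chart_ring : comNzRingType;
  chart_alg : {rmorphism K -> chart_ring};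
  chart_map :> rs_hom (Spec chart_ring) X;
  chart_immersion : open_immersion chart_map;
  chart_over : rs_comp (structure_map X) chart_map = Spec_map chart_alg
}.

Definition finitely_generated (K : fieldType) (A : comNzRingType)
    (iota : {rmorphism K -> A}) : Prop :=
  exists (n : nat) (x : 'I_n -> A),
    forall a : A, exists P : mpoly.mpoly n K, mpoly.mmap iota x P = a.

Definition finite_type (K : fieldType) (X : scheme_over K) : Prop :=
  exists (n : nat) (U : 'I_n -> chart X),
    (forall i, finitely_generated (chart_alg (U i))) /\
    (forall x : X, exists i, range (U i) x).

(* A = K[X_1, ..., X_n] / (f_1, ..., f_c), and the determinant of (df_i / dX_j),
   for i, j <= c, is invertible in A. Here x j is the class of X_j. A K-scheme is
   smooth at a point iff the point has an affine open neighbourhood Spec A of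
   this form. *)
Definition standard_smooth (K : fieldType) (A : comNzRingType)
    (iota : {rmorphism K -> A}) : Prop :=
  exists (n c : nat) (cn : (c <= n)%N) (x : 'I_n -> A)
    (f : 'I_c -> mpoly.mpoly n K),
  [/\ forall a : A, exists P : mpoly.mpoly n K, mpoly.mmap iota x P = a,
      forall P : mpoly.mpoly n K, mpoly.mmap iota x P = 0 <->
        exists g : 'I_c -> mpoly.mpoly n K, P = \sum_(i < c) g i * f i &
      exists b : A, b * \det (\matrix_(i < c, j < c)
        mpoly.mmap iota x (mpoly.mderiv (widen_ord cn j) (f i))) = 1].

Definition smooth_at (K : fieldType) (X : scheme_over K) (x : X) : Prop :=
  exists U : chart X, range U x /\ standard_smooth (chart_alg U).

Definition has_smooth_rational_point (K : fieldType) (X : scheme_over K) : Prop :=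
  exists2 x : X, rational_points X x & smooth_at x.

Definition large_field (K : fieldType) : Prop :=
  forall X : scheme_over K,
    geometrically_integral X -> finite_type X -> has_smooth_rational_point X ->
    dense (rational_points X).

(* The points of X(L) that do not come from X(F) for any proper subfield F of L
   containing K. *)
Definition new_points (K : fieldType) (X : scheme_over K) (L : fieldExtType K) :
    set (rs_hom (Spec L) X) :=
  points X (in_alg L) `\`
  [set h | exists2 F : {subfield L}, F != {:L}%AS &
     exists2 g, points X (in_alg (subvs_of F)) g &
       h = rs_comp g (Spec_map (vsval : subvs_of F -> L))].
Arguments new_points {K} X L.

(* Main.v *)
From HB Require Import structures.
Require Import Defs.
From mathcomp Require Import all_boot all_order all_algebra all_field.
From mathcomp Require Import ring_quotient generic_quotient.
From mathcomp Require Import boolp classical_sets functions cardinality.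
From mathcomp Require Import topology_structure.
From mathcomp Require Import ring.
Import -(notations) mpoly.

(** Near the smooth rational point, [X] is [f_1 = ... = f_c = 0] in affine
[n]-space, with an invertible Jacobian in the first [c] coordinates, and [c < n]
since [X] has positive dimension. Write [L = K(al)] and look for [L]-points whose
[c]-th coordinate is [a_c + t al], with [t] in [K], whose later coordinates are
those of the rational point, and whose first [c] coordinates are expanded in the
powers of [al]. This is a square system over [K] in the coefficients, again with
an invertible Jacobian (Weil restriction), and a solution with [t <> 0] is a new
point, because its [c]-th coordinate generates [L].

By Newton's iteration the system has a solution in [K[[t]]]. The [K]-algebra [Q]
generated by this solution inside [K[[t]]] and by the inverse of one suitable
element is a domain, stays one after any extension of scalars (it then embeds
into [K'[[t]]]), and is standard smooth: Hilbert's basis theorem and the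
determinant trick show that the equations generate, near the origin, all the
relations. So [Spec Q] is geometrically integral with a smooth rational point, and
as [K] is large, it has rational points at which [t] avoids any given finite set. *)

Set Implicit Arguments.
Unset Strict Implicit.
Unset Printing Implicit Defensive.

Import GRing.Theory.
Local Open Scope ring_scope.

Local Notation "{ 'mpoly' T [ n ] }" := (mpoly.mpoly n T).
Local Notation MX i := (mpolyX _ (mnm1 i)).
Local Notation MC c := (mpolyC _ c).

(** * Polynomial rings and the Hilbert basis theorem *)

(** Largeness speaks only of geometrically integral schemes, and the zero locus of the square system
    is not visibly irreducible. In the subring of [K[[t]]] generated by the formal solution,
    integrality is automatic over every extension of [K]; the price is that all relations of this
    subring must be found before smoothness can be asserted. The inverted element is [e = g * J]:
    [J] is the Jacobian determinant of the system, and [g], produced by the determinant trick,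
    multiplies every relation into the ideal of the equations. Both are [1] at the origin, hence
    units of [K[[t]]], so the inverse is adjoined without leaving that domain. The new points are
    told apart by [t]: were there finitely many, their parameters would form a finite set, and a
    solution whose [t] avoids it would be one more. If [c = n], the chart would be [Spec K], open in
    the irreducible [X], so [X] would be a point; this is how positive dimension enters. *)

Lemma mpoly_ring_ind (R : comNzRingType) n (S : {mpoly R[n]} -> Prop) :
  (forall c, S (MC c)) -> (forall i, S (MX i)) ->
  (forall p q, S p -> S q -> S (p + q)) ->
  (forall p q, S p -> S q -> S (p * q)) -> forall p, S p.
Proof.
move=> SC SX SD SM; apply: mpolyind => [|c m p _ _ Sp].
  by rewrite -mpolyC0.
apply: (SD) => //; rewrite -mul_mpolyC; apply: (SM) => //.
rewrite mpolyXE_id; apply: big_ind => [|x y Sx Sy|i _]; rewrite -?mpolyC1 //.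
  exact: SM.
by elim: (m i : nat) => [|k IH]; rewrite ?expr0 -?mpolyC1 // exprS; apply: SM.
Qed.

(** The composite [fg] is known only pointwise, so that it can be taken to be [idfun] when [g]
    retracts [f]. *)
Lemma rmorph_mmap (R S T : comNzRingType) n (f : {rmorphism R -> S})
    (g : {rmorphism S -> T}) (h : 'I_n -> S) (k : 'I_n -> T)
    (fg : R -> T) (P : {mpoly R[n]}) :
  (forall c, g (f c) = fg c) -> (forall i, g (h i) = k i) ->
  g (mmap f h P) = mmap fg k P.
Proof.
move=> fgE hk; rewrite /mmap rmorph_sum; apply: eq_bigr => m _.
rewrite rmorphM fgE /mmap1 rmorph_prod; congr (_ * _).
by apply: eq_bigr => i _; rewrite rmorphXn hk.
Qed.

Lemma mmapXU (R : nzRingType) (S : comNzRingType) n (f : {rmorphism R -> S})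
  (h : 'I_n -> S) i : mmap f h (MX i) = h i.
Proof. by rewrite mmapX mmap1U. Qed.

Lemma rmorph_mpoly_ext (R S : comNzRingType) n (f g : {rmorphism {mpoly R[n]} -> S}) :
  (forall c, f (MC c) = g (MC c)) -> (forall i, f (MX i) = g (MX i)) ->
  forall P, f P = g P.
Proof.
move=> fgC fgX; elim/mpoly_ring_ind => // p q ep eq.
  by rewrite !rmorphD ep eq.
by rewrite !rmorphM ep eq.
Qed.

Section Ideals.
Variable R : comPzRingType.

(** Unlike [idealr_closed], this admits the whole ring; ideals such as those of [ideal_unit] are
    shown to contain [1]. *)
Definition is_ideal (I : R -> Prop) :=
  [/\ I 0, forall x y, I x -> I y -> I (x + y) & forall a x, I x -> I (a * x)].

Definition gen_ideal r (G : 'I_r -> R) (x : R) :=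
  exists c : 'I_r -> R, x = \sum_(i < r) c i * G i.

Lemma gen_ideal_ideal r (G : 'I_r -> R) : is_ideal (gen_ideal G).
Proof.
split=> [|x y [c ->] [d ->]|a x [c ->]].
- by exists (fun=> 0); rewrite big1 // => i _; rewrite mul0r.
- by exists (fun i => c i + d i); rewrite -big_split; apply: eq_bigr => i _; rewrite mulrDl.
- by exists (fun i => a * c i); rewrite mulr_sumr; apply: eq_bigr => i _; rewrite mulrA.
Qed.

Lemma gen_ideal_gen r (G : 'I_r -> R) i : gen_ideal G (G i).
Proof.
exists (fun j => (j == i)%:R); rewrite (bigD1 i) //= eqxx mul1r big1 ?addr0 //.
by move=> j /negbTE ->; rewrite mul0r.
Qed.

Lemma is_ideal_sum (I : R -> Prop) (J : Type) (s : seq J) (P : pred J) (F : J -> R) :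
  is_ideal I -> (forall i, P i -> I (F i)) -> I (\sum_(i <- s | P i) F i).
Proof. by move=> [I0 ID _] IF; apply: big_ind. Qed.

Lemma is_idealN (I : R -> Prop) x : is_ideal I -> I x -> I (- x).
Proof. by move=> [_ _ IM] Ix; rewrite -mulN1r; apply: IM. Qed.

Lemma is_idealB (I : R -> Prop) x y : is_ideal I -> I x -> I y -> I (x - y).
Proof. by move=> iI Ix Iy; have [_ ID _] := iI; apply: ID => //; apply: is_idealN. Qed.

(* "[s] generates [I]" is stated as: [I] is contained in every ideal containing [s]. *)
Definition noetherian := forall I, is_ideal I -> exists s : seq R,
  (forall x, x \in s -> I x) /\
  forall J, is_ideal J -> (forall x, x \in s -> J x) -> forall x, I x -> J x.

Lemma noetherian_gens I : noetherian -> is_ideal I ->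
  exists r (G : 'I_r -> R), (forall i, I (G i)) /\ forall x, I x -> gen_ideal G x.
Proof.
move=> noeR iI; have [s [sI sJ]] := noeR I iI.
exists (size s), (fun i => s`_i); split=> [i|]; first by apply/sI/mem_nth.
apply: sJ (gen_ideal_ideal _) _ => x /(nthP 0)[k ks <-].
exact: (gen_ideal_gen (fun i : 'I_(size s) => s`_i) (Ordinal ks)).
Qed.

End Ideals.

Lemma noetherian_field (K : fieldType) : noetherian K.
Proof.
move=> I [I0 _ IM]; have [[x [Ix x0]]|nI] := pselect (exists x, I x /\ x != 0).
  exists [:: x]; split=> [y|J [_ _ JM] Jx y _]; first by rewrite inE => /eqP ->.
  by rewrite -(mulfVK x0 y); apply: JM; apply: Jx; rewrite inE.
exists [::]; split=> // J [J0 _ _] _ x Ix.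
have [->//|x0] := eqVneq x 0; case: nI.
by exists x.
Qed.

Lemma noetherian_image (R S : comPzRingType) (f : {rmorphism R -> S}) :
  (forall y, exists x, f x = y) -> noetherian R -> noetherian S.
Proof.
move=> fs noeR I iI; have [I0 ID IM] := iI.
have preim_id J : is_ideal J -> is_ideal (fun x => J (f x)).
  move=> [J0 JD JM]; split=> [|x y|a x].
  - by rewrite rmorph0.
  - by rewrite rmorphD; apply: JD.
  - by rewrite rmorphM; apply: JM.
have [s [sI sJ]] := noeR _ (preim_id I iI).
exists (map f s); split=> [_ /mapP[x xs ->]|J iJ Js y]; first exact: sI.
have [x <-] := fs y; apply: (sJ _ (preim_id J iJ)) => z zs.
by apply: Js; apply: map_f.
Qed.

Section HilbertBasis.
Variable R : comNzRingType.

Definition top_coef (I : {poly R} -> Prop) d a :=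
  exists F, [/\ I F, (size F <= d.+1)%N & F`_d = a].

Lemma top_coef_ideal I d : is_ideal I -> is_ideal (top_coef I d).
Proof.
move=> [I0 ID IM]; split=> [|_ _ [F [IF sF <-]] [G [IG sG <-]]|a _ [F [IF sF <-]]].
- by exists 0; rewrite size_poly0 coef0.
- exists (F + G); rewrite coefD; split=> //; first exact: ID.
  by rewrite (leq_trans (size_polyD _ _)) // geq_max sF.
- exists (a%:P * F); rewrite coefCM; split=> //; first exact: IM.
  by rewrite mul_polyC (leq_trans (size_scale_leq _ _)).
Qed.

Lemma top_coefS I d k a : is_ideal I -> top_coef I d a -> top_coef I (d + k) a.
Proof.
move=> [_ _ IM] [F [IF sF Fa]]; exists ('X^k * F); split.
- exact: IM.
- by rewrite (leq_trans (size_polyMleq _ _)) // size_polyXn /= addnC -addSn leq_add2r.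
- by rewrite coefXnM ltnNge leq_addl /= addnK.
Qed.

(** The degree-[d] coefficients of [s] generate [top_coef I d]. The witness is asked to lie in [I]
    as well as in [J], so that subtracting it from a member of [I] stays in [I]. *)
Lemma top_coef_gens I d : noetherian R -> is_ideal I -> exists s : seq {poly R},
  (forall F, F \in s -> I F) /\
  forall J, is_ideal J -> (forall F, F \in s -> J F) ->
  forall a, top_coef I d a -> top_coef (fun F => I F /\ J F) d a.
Proof.
move=> noeR iI; have [s [sI sJ]] := noeR _ (top_coef_ideal d iI).
have [t [tI ts]] : exists t : seq {poly R}, (forall F, F \in t -> I F) /\
    forall a, a \in s -> exists F, [/\ F \in t, (size F <= d.+1)%N & F`_d = a].
  elim: s sI {sJ} => [|a s IH] sI; first by exists [::].
  have [|t [tI ts]] := IH; first by move=> x xs; apply: sI; rewrite inE xs orbT.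
  have [|F [IF sF Fa]] := sI a; first by rewrite inE eqxx.
  exists (F :: t); split=> [G|b]; rewrite inE => /orP[/eqP->|] //; first exact: tI.
    by exists F; rewrite inE eqxx.
  by move=> /ts[G [Gt sG Gb]]; exists G; rewrite inE Gt orbT.
exists t; split=> // J iJ Jt; apply: sJ.
  apply: top_coef_ideal; case: iI iJ => [I0 ID IM] [J0 JD JM].
  split=> // [x y [Ix Jx] [Iy Jy]|a x [Ix Jx]]; first by split; [apply: ID|apply: JD].
  by split; [apply: IM|apply: JM].
by move=> a /ts[F [Ft sF Fa]]; exists F; split=> //; split; [apply: tI|apply: Jt].
Qed.

Theorem noetherian_poly : noetherian R -> noetherian {poly R}.
Proof.
move=> noeR I iI; have [I0 ID IM] := iI.
have iL : is_ideal (fun a => exists d, top_coef I d a).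
  split=> [|x y [d dx] [e ey]|a x [d dx]].
  - by exists 0%N; have [] := top_coef_ideal 0 iI.
  - exists (d + e)%N; have [_ D _] := top_coef_ideal (d + e) iI.
    by apply: D; [|rewrite addnC]; apply: top_coefS.
  - by exists d; have [_ _ M] := top_coef_ideal d iI; apply: M.
have [s [sL sJ]] := noeR _ iL.
have [D sD] : exists D, forall a, a \in s -> top_coef I D a.
  elim: s sL {sJ} => [|a s IH] sL; first by exists 0%N.
  have [|D sD] := IH; first by move=> x xs; apply: sL; rewrite inE xs orbT.
  have [|d da] := sL a; first by rewrite inE eqxx.
  exists (d + D)%N => b; rewrite inE => /orP[/eqP->|/sD Db]; first exact: top_coefS.
  by rewrite addnC; apply: top_coefS.
(* All generators of the union of the coefficient ideals already occur in degree [D], so these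
   ideals are stationary from [D] on. *)
have LD d a : top_coef I d a -> top_coef I D a.
  by move=> da; apply: (sJ _ (top_coef_ideal D iI)) => //; exists d.
have [S [SI SJ]] : exists S : seq {poly R}, (forall F, F \in S -> I F) /\
    forall J, is_ideal J -> (forall F, F \in S -> J F) ->
    forall d a, (d <= D)%N -> top_coef I d a -> top_coef (fun F => I F /\ J F) d a.
  elim: {sD LD}D => [|D [S [SI SJ]]].
    have [S [SI SJ]] := top_coef_gens 0 noeR iI; exists S; split=> // J iJ JS d a.
    by rewrite leqn0 => /eqP ->; apply: SJ.
  have [T [TI TJ]] := top_coef_gens D.+1 noeR iI; exists (S ++ T); split=> [F|J iJ JST d a].
    by rewrite mem_cat => /orP[/SI|/TI].
  rewrite leq_eqVlt => /orP[/eqP->|]; [apply: TJ|apply: SJ] => // F FT; apply: JST;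
    by rewrite mem_cat FT ?orbT.
exists S; split=> // J iJ JS F IF.
elim: {F}(size F) {-2}F (leqnn (size F)) IF => [|d IH] F sF IF.
  by move: sF; rewrite leqn0 size_poly_eq0 => /eqP ->; case: iJ.
(* Such a [G] cancels the top coefficient of [F], and the induction hypothesis applies to [F - G].
   Above degree [D], [G] is a polynomial of degree at most [D] shifted by a power of ['X]. *)
suff [G [[IG JG] sG GF]] : top_coef (fun F => I F /\ J F) d F`_d.
  rewrite -(subrK G F); have [_ JD _] := iJ; apply: JD => //; apply: IH; last exact: is_idealB.
  apply/leq_sizeP => k; rewrite leq_eqVlt => /orP[/eqP <-|dk]; rewrite coefB.
    by rewrite GF subrr.
  by rewrite !nth_default ?subrr // (leq_trans _ dk).
have Fd : top_coef I d F`_d by exists F.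
have [dD|/ltnW Dd] := leqP d D; first exact: SJ.
rewrite -(subnKC Dd); apply: top_coefS; last by rewrite subnKC //; exact: SJ (LD _ _ Fd).
case: iI iJ => [_ _ _] [J0 JD JM]; split=> // [x y [Ix Jx] [Iy Jy]|a x [Ix Jx]].
  by split; [apply: ID|apply: JD].
by split; [apply: IM|apply: JM].
Qed.

End HilbertBasis.

Lemma noetherian_mpoly (K : fieldType) n : noetherian {mpoly K[n]}.
Proof.
elim: n => [|n /noetherian_poly noe].
  apply: (noetherian_image (f := @mpolyC 0 K)) (@noetherian_field K) => P.
  by exists (mcoeff (@mnm0 0) P); exact/esym/nvar0_mpolyC.
pose w : {rmorphism {mpoly K[n]} -> {mpoly K[n.+1]}} :=
  mmap (@mpolyC n.+1 K) (fun i => MX (lift ord_max i)).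
pose f : {rmorphism {poly {mpoly K[n]}} -> {mpoly K[n.+1]}} :=
  horner_eval (MX ord_max) \o map_poly w.
apply: (noetherian_image (f := f)) noe; elim/mpoly_ring_ind => [c|i|p q|p q].
- by exists (MC c)%:P; rewrite /= /horner_eval map_polyC hornerC /w /= mmapC.
- have [j ->|->] := unliftP ord_max i; last by exists 'X; rewrite /= /horner_eval map_polyX hornerX.
  by exists (MX j)%:P; rewrite /= /horner_eval map_polyC hornerC /w /= mmapXU.
- by move=> [x <-] [y <-]; exists (x + y); rewrite rmorphD.
- by move=> [x <-] [y <-]; exists (x * y); rewrite rmorphM.
Qed.

(** * The algebra of a formal branch *)

Lemma prime_quotient (A : comNzRingType) (p : spec_pt A) :
  exists (Q : comNzRingType) (pi : {rmorphism A -> Q}),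
    (forall y, exists x, pi x = y) /\ (forall x, pi x = 0 <-> x \in p).
Proof.
pose I : prime_idealr A := p.
exists {ideal_quot I}, (\pi_{ideal_quot I}%qT : {rmorphism A -> {ideal_quot I}}); split=> [y|x].
  by exists (repr y); exact: reprK.
have -> : (x \in p) = (\pi_{ideal_quot I}%qT x == \pi_{ideal_quot I}%qT 0).
  by rewrite -Quotient.idealrBE subr0.
by rewrite rmorph0; split=> /eqP.
Qed.

Lemma rmorph_factor (A Q B : comPzRingType) (pi : {rmorphism A -> Q})
    (g : {rmorphism A -> B}) :
  (forall y, exists x, pi x = y) -> (forall x, pi x = 0 -> g x = 0) ->
  exists h : {rmorphism Q -> B}, forall x, h (pi x) = g x.
Proof.
move=> pis pig; have [s sK] := choice pis.
have gs x : g (s (pi x)) = g x.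
  by apply/eqP; rewrite -subr_eq0 -rmorphB; apply/eqP/pig; rewrite rmorphB sK subrr.
have hZ : zmod_morphism (g \o s).
  by move=> x y; rewrite -[x]sK -[y]sK -rmorphB /= !gs rmorphB.
have hM : monoid_morphism (g \o s).
  split=> [|x y]; first by rewrite -(rmorph1 pi) /= gs rmorph1.
  by rewrite -[x]sK -[y]sK -rmorphM /= !gs rmorphM.
pose hzI := GRing.isZmodMorphism.Build Q B (g \o s) hZ.
pose hmI := GRing.isMonoidMorphism.Build Q B (g \o s) hM.
pose h : {rmorphism Q -> B} := HB.pack (g \o s) hzI hmI.
by exists h => x /=; rewrite gs.
Qed.

(** The zero ring qualifies, so that this also covers sections over the empty open set. *)
Definition no_zero_divisors (R : pzRingType) :=
  forall x y : R, x * y = 0 -> x = 0 \/ y = 0.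

(** [R] stands for the tensor product of [A] and [K'] over [K]. Existence of [theta] is what makes
    every affine chart of a fibre product factor through [Spec R]. *)
Definition weak_pushout (K A K' R : comNzRingType)
    (iota : {rmorphism K -> A}) (f : {rmorphism K -> K'})
    (alpha : {rmorphism A -> R}) (beta : {rmorphism K' -> R}) :=
  (forall c, alpha (iota c) = beta (f c)) /\
  forall (B : comNzRingType) (phi : {rmorphism A -> B}) (psi : {rmorphism K' -> B}),
    (forall c, phi (iota c) = psi (f c)) ->
    exists theta : {rmorphism R -> B},
      (forall a, theta (alpha a) = phi a) /\ (forall c, theta (beta c) = psi c).

Definition geometric_domain (K : fieldType) (A : comNzRingType)
    (iota : {rmorphism K -> A}) :=
  forall (K' : fieldType) (f : {rmorphism K -> K'}),
  exists (R : comNzRingType) (alpha : {rmorphism A -> R}) (beta : {rmorphism K' -> R}),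
    no_zero_divisors R /\ weak_pushout iota f alpha beta.

Lemma dvdXnP (K : fieldType) n (p : {poly K}) :
  reflect (forall l, (l < n)%N -> p`_l = 0) ('X^n %| p).
Proof.
apply: (iffP idP) => [/dvdpP[q ->] l ln|p0]; first by rewrite coefMXn ln.
rewrite -(poly_take_drop n p) (_ : take_poly n p = 0) ?add0r ?dvdp_mull //.
by apply/polyP => l; rewrite coef_take_poly coef0; case: ifP => // /p0.
Qed.

Lemma mmap_dvd (K : fieldType) n (u v : 'I_n -> {poly K}) (d : {poly K}) P :
  (forall i, d %| u i - v i) ->
  d %| mmap (@polyC K) u P - mmap (@polyC K) v P.
Proof.
move=> duv; elim/mpoly_ring_ind: P => [c|i|p q dp dq|p q dp dq].
- by rewrite /= !mmapC subrr dvdp0.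
- by rewrite !mmapXU.
- by rewrite !rmorphD opprD addrACA dvdp_add.
- rewrite !rmorphM /= -[X in _ %| X](_ : (mmap polyC u p - mmap polyC v p) * mmap polyC u q
    + mmap polyC v p * (mmap polyC u q - mmap polyC v q) = _); last by ring.
  by apply: dvdp_add; [apply: dvdp_mulr|apply: dvdp_mull].
Qed.

(* A coherent sequence of points over [F[t]/(t^k)] is a point over [F[[t]]],
   so that the ideal below is the kernel of an evaluation [F[X] -> F[[t]]]. *)
Section Branch.
Variables (F : fieldType) (M : nat) (z : nat -> 'I_M -> {poly F}).

Definition coherent := forall k i, 'X^(k.+1) %| z k.+1 i - z k i.

Definition branch_eval k : {mpoly F[M]} -> {poly F} := mmap (@polyC F) (z k).
HB.instance Definition _ k := GRing.RMorphism.on (branch_eval k).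

Definition branch_ideal (P : {mpoly F[M]}) : bool :=
  `[< forall k, 'X^(k.+1) %| branch_eval k P >].

Lemma branch_idealP P : reflect (forall k, 'X^(k.+1) %| branch_eval k P) (P \in branch_ideal).
Proof. exact: asboolP. Qed.

Lemma branch_ideal_closed : idealr_closed branch_ideal.
Proof.
split=> [||a x y].
- by apply/branch_idealP => k; rewrite rmorph0 dvdp0.
- apply/branch_idealP => /(_ 0%N); rewrite rmorph1 dvdp1.
  by rewrite size_polyXn.
- move=> /branch_idealP xI /branch_idealP yI; apply/branch_idealP => k.
  by rewrite rmorphD rmorphM dvdp_add // dvdp_mull.
Qed.

Hypothesis zc : coherent.

Lemma branch_eval_le k l P : (k <= l)%N -> 'X^(k.+1) %| branch_eval l P - branch_eval k P.
Proof.
move=> /subnKC <-; elim: (l - k)%N => [|d IH]; first by rewrite addn0 subrr dvdp0.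
rewrite addnS -(subrK (branch_eval (k + d) P) (branch_eval (k + d).+1 P)) -addrA dvdp_add //.
apply: mmap_dvd => i; apply: dvdp_trans (zc _ _).
by rewrite dvdp_exp2l // ltnS leq_addr.
Qed.

(** As in [K[[t]]], lowest terms multiply: if [P] and [Q] have orders [a <= k] and [b <= l], seen at
    levels [k] and [l], then the coefficient of degree [a + b] in [P * Q] at level [k + l] is a
    product of nonzero elements. *)
Lemma branch_prime : prime_idealr_closed branch_ideal.
Proof.
have nI P : P \notin branch_ideal -> exists k l, [/\ (l <= k)%N,
    'X^l %| branch_eval k P & (branch_eval k P)`_l != 0].
  move=> nP; have [k] : exists k, ~~ ('X^(k.+1) %| branch_eval k P).
    apply: contrapT => h; move/negP: nP; apply; apply/branch_idealP => k.
    by apply: contrapT => /negP hk; apply: h; exists k.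
  move=> nX; have exl : exists l, (l < k.+1)%N && ((branch_eval k P)`_l != 0).
    apply: contrapT => h; case/negP: nX; apply/dvdXnP => l lk; apply/eqP.
    by apply: contrapT => /negP hl; apply: h; exists l; rewrite lk.
  case: (ex_minnP exl) => m /andP[mk Pm] mmin.
  exists k, m; split=> //; apply/dvdXnP => j jm; apply/eqP.
  apply/negPn/negP => Pj; have := mmin j.
  by rewrite Pj (ltn_trans jm mk) leqNgt jm => /(_ isT).
move=> P Q PQ; apply: contrapT => /negP; rewrite negb_or => /andP[].
move=> /nI[k [a [ak Pa Pa0]]] /nI[l [b [bl Qb Qb0]]].
have PQX := branch_idealP _ PQ (k + l)%N; rewrite rmorphM /= in PQX.
have coefE (R : {mpoly F[M]}) j m i : (j <= m)%N -> (i <= j)%N ->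
    (branch_eval m R)`_i = (branch_eval j R)`_i.
  move=> jm ij; apply/eqP; rewrite -subr_eq0 -coefB.
  by move/(branch_eval_le R)/dvdXnP: jm => ->.
have {}Pa : 'X^a %| branch_eval (k + l) P.
  apply/dvdXnP => i ia; rewrite (coefE _ k) ?leq_addr //; last exact: leq_trans (ltnW ia) ak.
  by move/dvdXnP: Pa => ->.
have {}Qb : 'X^b %| branch_eval (k + l) Q.
  apply/dvdXnP => i ib; rewrite (coefE _ l) ?leq_addl //; last exact: leq_trans (ltnW ib) bl.
  by move/dvdXnP: Qb => ->.
have {}Pa0 : (branch_eval (k + l) P)`_a != 0 by rewrite (coefE _ k) ?leq_addr.
have {}Qb0 : (branch_eval (k + l) Q)`_b != 0 by rewrite (coefE _ l) ?leq_addl.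
case/dvdpP: Pa Pa0 PQX => p ->; case/dvdpP: Qb Qb0 => q ->.
rewrite !coefMXn !ltnn !subnn => q0 p0 /dvdXnP /(_ (a + b)%N).
rewrite ltnS leq_add // => /(_ isT) /eqP.
rewrite mulrACA -exprD coefMXn ltnn subnn coef0M mulf_eq0.
by rewrite (negbTE p0) (negbTE q0).
Qed.

Definition branch_pt : spec_pt {mpoly F[M]} := SpecPt branch_ideal_closed branch_prime.

End Branch.

Section BranchBaseChange.
Variables (K K' : fieldType) (f : {rmorphism K -> K'}) (M : nat).
Variable z : nat -> 'I_M -> {poly K}.

Definition branch_map k i := map_poly f (z k i).

Lemma branch_map_coherent : coherent z -> coherent branch_map.
Proof.
by move=> zc k i; rewrite /branch_map -rmorphB -(map_polyXn f) dvdp_map.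
Qed.

Definition map_mp : {mpoly K[M]} -> {mpoly K'[M]} :=
  mmap (@mpolyC M K' \o f) (fun i => MX i).
HB.instance Definition _ := GRing.RMorphism.on map_mp.

Lemma map_mpC c : map_mp (MC c) = MC (f c).
Proof. exact: mmapC. Qed.

Lemma branch_eval_map k P :
  branch_eval branch_map k (map_mp P) = map_poly f (branch_eval z k P).
Proof.
rewrite /map_mp (@rmorph_mmap _ _ _ _ _ (branch_eval branch_map k) _
  (branch_map k) (polyC \o f)) => [|c|i]; last by rewrite /= /branch_eval mmapXU.
  rewrite (@rmorph_mmap _ _ _ _ _ (map_poly f) _ (branch_map k) (polyC \o f)) //.
  by move=> c; rewrite /= map_polyC.
by rewrite /= /branch_eval mmapC.
Qed.

Lemma map_mp_ideal P : P \in branch_ideal z -> map_mp P \in branch_ideal branch_map.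
Proof.
move=> /branch_idealP PI; apply/branch_idealP => k.
by rewrite branch_eval_map -(map_polyXn f) dvdp_map.
Qed.

(* Coefficients in [K'] may be taken linearly independent over [K]; the
   vanishing of a combination can then be tested coefficientwise. *)
Lemma branch_ideal_span (J : {mpoly K'[M]} -> Prop) : is_ideal J ->
  (forall P, P \in branch_ideal z -> J (map_mp P)) ->
  forall P, P \in branch_ideal branch_map -> J P.
Proof.
move=> iJ zJ.
suff main r (e : 'I_r -> K') (P : 'I_r -> {mpoly K[M]}) :
    \sum_(i < r) MC (e i) * map_mp (P i) \in branch_ideal branch_map ->
    J (\sum_(i < r) MC (e i) * map_mp (P i)).
  move=> P; have -> : P = \sum_(i < size (msupp P))
      MC (mcoeff (nth (@mnm0 M) (msupp P) i) P) * map_mp (mpolyX _ (nth (@mnm0 M) (msupp P) i)).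
    rewrite [LHS]mpolyE (big_nth (@mnm0 M)) big_mkord; apply: eq_bigr => i _.
    rewrite -mul_mpolyC /map_mp; congr (_ * _).
    by rewrite mmapX mmap1_id.
  exact: main.
elim: r e P => [|r IH] e P; first by rewrite !big_ord0; case: iJ.
(* A relation over [K] expresses [e k] through the other [e i] and saves one term. Without relations
   each [P i] lies in the branch ideal, since a nonzero coefficient of some [P i] would yield the
   relation formed by the same coefficient of all [P j]. *)
have [[c [k [ck ce]]]|indep] := pselect (exists c : 'I_r.+1 -> K, exists k,
    c k != 0 /\ \sum_i f (c i) * e i = 0).
  have -> : \sum_(i < r.+1) MC (e i) * map_mp (P i) =
      \sum_(i < r) MC (e (lift k i)) * map_mp (P (lift k i) - MC (c (lift k i) / c k) * P k).
    have fk : f (c k) != 0 by rewrite fmorph_eq0.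
    have ek : e k = - \sum_(i < r) f (c (lift k i) / c k) * e (lift k i).
      apply: (mulfI fk); rewrite mulrN mulr_sumr.
      apply/eqP; rewrite -addr_eq0; apply/eqP.
      rewrite -[RHS]ce [RHS](bigD1_ord k) //=; congr (_ + _); apply: eq_bigr => i _.
      by rewrite fmorph_div mulrCA mulrA mulfVK.
    rewrite (bigD1_ord k) //= ek rmorphN /= rmorph_sum mulNr mulr_suml addrC -sumrB.
    apply: eq_bigr => i _; rewrite rmorphB (rmorphM map_mp) /= map_mpC !rmorphM /=.
    by ring.
  exact: IH.
move=> PI; apply: is_ideal_sum => // i _; have [_ _ JM] := iJ; apply: JM; apply: zJ.
apply/branch_idealP => k; apply/dvdXnP => l lk; apply: contrapT => /eqP Pil.
apply: indep; exists (fun j => (branch_eval z k (P j))`_l), i; split=> //.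
move/branch_idealP/(_ k)/dvdXnP/(_ l lk): PI; rewrite rmorph_sum coef_sum => PI; rewrite -[RHS]PI.
apply: eq_bigr => j _; rewrite rmorphM /= branch_eval_map.
by rewrite /branch_eval mmapC coefCM coef_map mulrC.
Qed.

End BranchBaseChange.

Section BranchRing.
Variables (K : fieldType) (M : nat) (z : nat -> 'I_M -> {poly K}).
Hypothesis zc : coherent z.

(** Over [K'] the ring [R] is the quotient attached to the same branch with coefficients mapped to
    [K']. It is a domain for the same reason as [Q], and [branch_ideal_span] says that it has no
    relations beyond those of [Q]. *)
Lemma branch_ring : exists (Q : comNzRingType) (pi : {rmorphism {mpoly K[M]} -> Q}),
  [/\ forall y, exists x, pi x = y, forall P, pi P = 0 <-> P \in branch_ideal z,
      no_zero_divisors Q &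
      geometric_domain (pi \o @mpolyC M K : {rmorphism _ -> _})].
Proof.
have nzd (F : fieldType) (y : nat -> 'I_M -> {poly F}) (Q : comNzRingType)
    (pi : {rmorphism {mpoly F[M]} -> Q}) : coherent y ->
    (forall q, exists x, pi x = q) -> (forall P, pi P = 0 <-> P \in branch_ideal y) ->
    no_zero_divisors Q.
  move=> yc pis piI a b; have [P <-] := pis a; have [P' <-] := pis b.
  rewrite -rmorphM => /piI /(branch_prime yc) /orP[] /piI; first by left.
  by right.
have [Q [pi [pis piI]]] := prime_quotient (branch_pt zc).
exists Q, pi; split=> //; first exact: nzd zc pis piI.
move=> K' f; have zc' := branch_map_coherent f zc.
have [R [rho [rhos rhoI]]] := prime_quotient (branch_pt zc').
have [|alpha alphaE] := @rmorph_factor _ _ _ pi (rho \o @map_mp _ _ f M : {rmorphism _ -> _}) pis.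
  by move=> P /piI PI; apply/rhoI; apply: map_mp_ideal.
exists R, alpha, (rho \o @mpolyC M K' : {rmorphism _ -> _}).
split; first exact: nzd zc' rhos rhoI.
split=> [c|B phi psi e]; first by rewrite /= alphaE /= /map_mp mmapC.
pose g : {rmorphism {mpoly K'[M]} -> B} := mmap psi (fun i => phi (pi (MX i))).
have gE P : g (map_mp f P) = phi (pi P).
  elim/mpoly_ring_ind: P => [c|i|p q ep eq|p q ep eq].
  - by rewrite map_mpC /g /= mmapC; apply: esym (e c).
  - by rewrite /map_mp /g /= !mmapXU.
  - by rewrite !rmorphD ep eq.
  - by rewrite !rmorphM ep eq.
have [|theta thetaE] := rmorph_factor (g := g) rhos.
  move=> P /rhoI; apply: (@branch_ideal_span _ _ f M z (fun P => g P = 0)) => {P}.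
    split=> [|x y x0 y0|a x x0]; first by rewrite rmorph0.
    - by rewrite rmorphD x0 y0 addr0.
    - by rewrite rmorphM x0 mulr0.
  by move=> P PI; rewrite gE; have /piI -> : P \in branch_pt zc by []; rewrite rmorph0.
exists theta; split=> [a|c]; last by rewrite thetaE /g /= mmapC.
by have [P <-] := pis a; rewrite alphaE thetaE gE.
Qed.

End BranchRing.

(** * Newton iteration *)

Lemma mevalXv (R : comNzRingType) n (v : 'I_n -> R) i : meval v (MX i) = v i.
Proof. exact: mevalXU. Qed.

Lemma mderiv_var (R : comNzRingType) n (i l : 'I_n) :
  mderiv i (MX l) = (l == i)%:R :> {mpoly R[n]}.
Proof.
rewrite mderivX mnm1E; have [->|_] := eqVneq l i; last by rewrite scale0r.
rewrite scale1r (_ : mnm_sub _ _ = @mnm0 n) ?mpolyX0 //.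
by apply/mnmP => j; rewrite mnmBE mnm0E subnn.
Qed.

(** First-order Taylor expansion at [a]. The [D j] are not unique, but their values at [a] are the
    partial derivatives. *)
Lemma hadamard (R : comNzRingType) n (a : 'I_n -> R) (P : {mpoly R[n]}) :
  exists D : 'I_n -> {mpoly R[n]},
    P = MC (meval a P) + \sum_j (MX j - MC (a j)) * D j /\
    forall j, meval a (D j) = meval a (mderiv j P).
Proof.
elim/mpoly_ring_ind: P => [c|i|p q [D [Dp Da]] [E [Eq Ea]]|p q [D [Dp Da]] [E [Eq Ea]]].
- exists (fun=> 0); split=> [|j]; last by rewrite mderivC meval0.
  by rewrite big1 ?addr0 ?mevalC // => j _; rewrite mulr0.
- exists (fun j => (i == j)%:R); split=> [|j]; last by rewrite mderiv_var.
  rewrite (bigD1 i) //= eqxx mulr1 big1 ?addr0; first by rewrite mevalXv addrC subrK.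
  by move=> j; rewrite eq_sym => /negbTE ->; rewrite mulr0.
- exists (fun j => D j + E j); split=> [|j]; last by rewrite mderivD !mevalD Da Ea.
  rewrite {1}Dp {1}Eq mevalD mpolyCD addrACA -big_split; congr (_ + _).
  by apply: eq_bigr => j _; rewrite mulrDr.
- exists (fun j => p * E j + MC (meval a q) * D j); split=> [|j].
    rewrite {1}Eq mulrDr {1}Dp mulrDl mevalM mpolyCM -addrA; congr (_ + _).
    rewrite mulr_suml mulr_sumr -big_split; apply: eq_bigr => j _ /=; ring.
  by rewrite mderivM !(mevalD, mevalM) mevalC Da Ea; ring.
Qed.

Lemma hadamard_root (R : comNzRingType) n (a : 'I_n -> R) (P : {mpoly R[n]}) :
  meval a P = 0 -> exists D : 'I_n -> {mpoly R[n]},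
    P = \sum_j (MX j - MC (a j)) * D j /\ forall j, meval a (D j) = meval a (mderiv j P).
Proof.
have [D [PD DE]] := hadamard a P => P0; exists D; split=> //.
by rewrite {1}PD P0 mpolyC0 add0r.
Qed.

Lemma hadamard0 (R : comNzRingType) n (P : {mpoly R[n]}) : meval (fun=> 0) P = 0 ->
  exists D : 'I_n -> {mpoly R[n]}, P = \sum_j MX j * D j.
Proof.
move=> /hadamard_root[D [PD _]]; exists D; rewrite {1}PD.
by apply: eq_bigr => j _; rewrite mpolyC0 subr0.
Qed.

Lemma cramer (R : comNzRingType) n (A : 'M[R]_n) (v w : 'I_n -> R) :
  (forall i, \sum_j A i j * v j = w i) ->
  forall j, \det A * v j = \sum_i (\adj A)%R j i * w i.
Proof.
move=> Av j; have: \adj A *m (A *m \col_j v j) = \adj A *m \col_i w i.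
  by congr (_ *m _); apply/matrixP => i k; rewrite !mxE -Av; apply: eq_bigr => l _; rewrite mxE.
rewrite mulmxA mul_adj_mx mul_scalar_mx => /matrixP/(_ j 0).
by rewrite !mxE => ->; apply: eq_bigr => i _; rewrite !mxE.
Qed.

Lemma sum_dvdp (F : fieldType) (I : Type) (s : seq I) (d : {poly F}) (G : I -> {poly F}) :
  (forall i, d %| G i) -> d %| \sum_(i <- s) G i.
Proof.
move=> dG; elim: s => [|i s IH]; first by rewrite big_nil dvdp0.
by rewrite big_cons dvdp_add.
Qed.

Section Newton.
Variables (K : fieldType) (N : nat).
Variables (B : 'I_N -> {mpoly K[N.+1]}) (C : 'I_N -> 'I_N -> {mpoly K[N.+1]}).

(** The last variable is the parameter [t], the others are the unknowns. As the [C i j] vanish at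
    the origin, the Jacobian in the unknowns is the identity there. *)
Definition newton_eq i : {mpoly K[N.+1]} :=
  MX (lift ord_max i) + MX ord_max * B i + \sum_j MX (lift ord_max j) * C i j.

Hypothesis C0 : forall i j, meval (fun=> 0) (C i j) = 0.

Definition newton_ext (u : 'I_N -> {poly K}) (i : 'I_N.+1) : {poly K} :=
  if unlift ord_max i is Some j then u j else 'X.

(** Each equation is solved for its isolated unknown and iterated from zero. This is Newton's method
    with the Jacobian frozen at the identity, so it gains one power of ['X] per step. *)
Fixpoint newton_seq k : 'I_N -> {poly K} :=
  if k is k'.+1 then fun i =>
    let ev := mmap (@polyC K) (newton_ext (newton_seq k')) in
    - ('X * ev (B i) + \sum_j newton_seq k' j * ev (C i j))
  else fun=> 0.

Definition newton_branch k := newton_ext (newton_seq k).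

Lemma newton_seqS k i : newton_seq k.+1 i =
  - ('X * mmap (@polyC K) (newton_branch k) (B i) +
     \sum_j newton_seq k j * mmap (@polyC K) (newton_branch k) (C i j)).
Proof. by []. Qed.

Lemma newton_seq_dvdX k j : 'X %| newton_seq k j.
Proof.
elim: k j => [|k IH] j /=; first exact: dvdp0.
rewrite dvdpNr dvdp_add ?dvdp_mulr //.
by apply: sum_dvdp => i; apply: dvdp_mulr.
Qed.

Lemma mmap_polyC0 n (P : {mpoly K[n]}) :
  mmap (@polyC K) (fun=> 0) P = (meval (fun=> 0) P)%:P.
Proof.
symmetry; rewrite /meval.
exact: (@rmorph_mmap _ _ _ _ idfun (@polyC K) (fun=> 0) (fun=> 0) (@polyC K) P
  (fun=> erefl) (fun=> polyC0 K)).
Qed.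

Lemma newton_coef_dvdX k i j : 'X %| mmap (@polyC K) (newton_branch k) (C i j).
Proof.
rewrite -(subrK (mmap (@polyC K) (fun=> 0) (C i j)) (mmap _ _ _)).
rewrite mmap_polyC0 C0 addr0 -[X in _ - X]/(0%:P) -(C0 i j) -mmap_polyC0.
apply: mmap_dvd => l; rewrite subr0 /newton_branch /newton_ext.
by case: (unliftP ord_max l) => [m _|_]; rewrite ?newton_seq_dvdX.
Qed.

Lemma newton_branch_coherent : coherent newton_branch.
Proof.
move=> k i; rewrite /newton_branch /newton_ext.
case: (unliftP ord_max i) => [j _|_]; last by rewrite subrr dvdp0.
elim: k j {i} => [|k IH] j; first by rewrite subr0 newton_seq_dvdX.
have evk P : 'X^(k.+1) %| mmap (@polyC K) (newton_branch k.+1) P -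
    mmap (@polyC K) (newton_branch k) P.
  apply: mmap_dvd => l; rewrite /newton_branch /newton_ext.
  by case: (unliftP ord_max l) => [m _|_]; rewrite ?subrr ?dvdp0.
rewrite newton_seqS (newton_seqS k j).
set ev := mmap _ (newton_branch k) in evk *.
set ev' := mmap _ (newton_branch k.+1) in evk *.
rewrite opprK addrC opprD addrA; set u := newton_seq k.+1 in IH *.
(* In every product below one factor is a difference divisible by ['X^(k.+1)]; the other is ['X], a
   value of [C] or an iterate, and supplies the additional ['X]. *)
have -> : 'X * ev (B j) + \sum_j0 newton_seq k j0 * ev (C j j0) - 'X * ev' (B j)
   - \sum_j0 u j0 * ev' (C j j0) = - ('X * (ev' (B j) - ev (B j))
   + \sum_l ((u l - newton_seq k l) * ev' (C j l) + newton_seq k l * (ev' (C j l) - ev (C j l)))).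
  have -> : \sum_l ((u l - newton_seq k l) * ev' (C j l)
       + newton_seq k l * (ev' (C j l) - ev (C j l))) =
     \sum_l u l * ev' (C j l) - \sum_l newton_seq k l * ev (C j l).
    by rewrite -sumrB; apply: eq_bigr => l _; ring.
  by ring.
rewrite dvdpNr exprS dvdp_add ?dvdp_mul //.
apply: sum_dvdp => l; apply: dvdp_add; last by rewrite dvdp_mul ?newton_seq_dvdX.
by rewrite mulrC dvdp_mul //; exact: (newton_coef_dvdX k.+1).
Qed.

(** At level [k] the equation takes the value [newton_seq k i - newton_seq k.+1 i], which coherence
    controls. *)
Lemma newton_eq_ideal i : newton_eq i \in branch_ideal newton_branch.
Proof.
apply/branch_idealP => k; rewrite /branch_eval /newton_eq !rmorphD rmorphM rmorph_sum /=.
have evY j : mmap polyC (newton_branch k) (MX (lift ord_max j)) = newton_seq k j.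
  by rewrite mmapXU /newton_branch /newton_ext liftK.
rewrite evY mmapXU {1}/newton_branch /newton_ext unlift_none.
rewrite (eq_bigr (fun j => newton_seq k j * mmap polyC (newton_branch k) (C i j))); last first.
  by move=> j _; rewrite rmorphM /= evY.
have := newton_branch_coherent k (lift ord_max i).
by rewrite /newton_branch /newton_ext liftK newton_seqS -opprD dvdpNr addrC addrA.
Qed.

Let H := newton_eq.
Let I := branch_ideal newton_branch.

(* The ideal [I] of the branch lies in the ideal of the origin, which [\det (1 + C)]
   multiplies into [(H, t)]; hence [\det (1 + C) I <= (H) + t I], and the
   determinant trick applies as [I] is finitely generated. *)
Lemma newton_kernel : exists g, meval (fun=> 0) g = 1 /\
  forall P, P \in I -> gen_ideal H (g * P).
Proof.
pose t : {mpoly K[N.+1]} := MX ord_max.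
have iH := gen_ideal_ideal H; have [H0 HD HM] := iH.
pose II P := is_true (P \in I).
have iI : is_ideal II.
  pose p := branch_pt newton_branch_coherent.
  by split=> [|x y xI yI|a x xI];
    [exact: (rpred0 p)|exact: (rpredD (S := p))|exact: (@idealMr _ p)].
have [_ _ IM] := iI.
pose A := (\matrix_(i < N, j < N) ((i == j)%:R + C i j)).
have det0 r (E : 'M[{mpoly K[N.+1]}]_r) :
    (forall i j, meval (fun=> 0) (E i j) = (i == j)%:R) -> meval (fun=> 0) (\det E) = 1.
  move=> E0; rewrite -det_map_mx (_ : map_mx _ E = 1%:M) ?det1 //.
  by apply/matrixP => i j; rewrite !mxE; apply: E0.
have A0 : meval (fun=> 0) (\det A) = 1.
  by apply: det0 => i j; rewrite mxE mevalD C0 addr0 rmorph_nat.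
have IP : forall P, P \in I -> exists P1, P1 \in I /\ gen_ideal H (\det A * P - t * P1).
  (* Membership of [P1] in [I] is automatic: [t * P1] lies in [I], and dividing its value at level
     [k.+1] by ['X] gives the divisibility required at level [k]. *)
  move=> P PI; suff [P1 HP1] : exists P1, gen_ideal H (\det A * P - t * P1).
    exists P1; split=> //; apply/branch_idealP => k.
    have HI x : gen_ideal H x -> II x.
      by move=> [c ->]; apply: is_ideal_sum => // i _; apply/IM/newton_eq_ideal.
    have tP1 : t * P1 \in I.
      rewrite -[t * P1](subKr (\det A * P)).
      by apply: (is_idealB iI); [exact: IM|exact: HI].
    have := branch_idealP _ _ tP1 k.+1; rewrite rmorphM /= /branch_eval mmapXU.
    rewrite {1}/newton_branch /newton_ext unlift_none exprS dvdp_mul2l ?polyX_eq0 //.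
    have := branch_eval_le newton_branch_coherent P1 (leqnSn k).
    rewrite -/(branch_eval newton_branch k.+1 P1) => d1 d2.
    by have := dvdp_sub d2 d1; rewrite subKr.
  pose J x := exists y, gen_ideal H (x - t * y).
  have iJ : is_ideal J.
    split=> [|x y [x' hx] [y' hy]|a x [x' hx]].
    - by exists 0; rewrite mulr0 subr0.
    - by exists (x' + y'); rewrite mulrDr opprD addrACA; apply: HD.
    - by exists (a * x'); rewrite mulrCA -mulrBr; apply: HM.
  have [J0 JD JM] := iJ.
  have tJ x : J (t * x) by exists x; rewrite subrr.
  have HJ x : gen_ideal H x -> J x by move=> hx; exists 0; rewrite mulr0 subr0.
  (* [J] is the ideal generated by the equations and [t]. The equations read [A Y = H - t B], so
     Cramer's rule puts [\det A] times each unknown into [J]. *)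
  have YJ j : J (\det A * MX (lift ord_max j)).
    have AY i : \sum_l A i l * MX (lift ord_max l) = H i - t * B i.
      rewrite /H /newton_eq addrAC addrK.
      under eq_bigr => l _ do rewrite mxE mulrDl [C i l * _]mulrC.
      rewrite big_split /= (bigD1 i) //= eqxx mul1r big1 ?addr0 // => l.
      by rewrite eq_sym => /negbTE ->; rewrite mul0r.
    have /= -> := cramer (v := fun l => MX (lift ord_max l)) AY j.
    apply: is_ideal_sum => // i _; apply: JM; apply: (is_idealB iJ) => //.
    exact/HJ/gen_ideal_gen.
  have P0 : meval (fun=> 0) P = 0.
    have := branch_idealP _ _ PI 0%N; rewrite expr1 /branch_eval.
    have -> : mmap polyC (newton_branch 0) P =
       (mmap polyC (newton_branch 0) P - mmap polyC (fun=> 0) P) + (meval (fun=> 0) P)%:P.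
      by rewrite mmap_polyC0 subrK.
    rewrite dvdp_addr; last first.
      apply: mmap_dvd => l; rewrite subr0 /newton_branch /newton_ext.
      by case: (unliftP ord_max l) => [m _|_]; rewrite ?newton_seq_dvdX.
    rewrite -['X]expr1 => /dvdXnP/(_ 0%N isT); by rewrite coefC.
  rewrite -/(J (\det A * P)).
  have [D ->] := hadamard0 P0; rewrite mulr_sumr.
  apply: is_ideal_sum => // j _.
  have [l ->|->] := unliftP ord_max j.
    by rewrite mulrA mulrC; apply: JM.
  by rewrite mulrCA; apply: tJ.
have [r [G [GI Ggen]]] := noetherian_gens (@noetherian_mpoly K N.+1) iI.
have /choice[M HM1] : forall i : 'I_r, exists m : 'I_r -> {mpoly K[N.+1]},
    gen_ideal H (\det A * G i - t * \sum_k m k * G k).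
  move=> i; have [P1 [/Ggen[m ->] h]] := IP _ (GI i).
  by exists m.
(* [E] maps the vector of generators [G] into the ideal of [H], hence so does multiplication by
   [\det E]. At the origin [E] is the identity, because [t] vanishes and [\det A] is [1] there. *)
pose E := (\matrix_(i < r, k < r) ((i == k)%:R * \det A - t * M i k)).
exists (\det E); split.
  apply: det0 => i j; rewrite mxE mevalB !mevalM A0 mevalXv mul0r subr0 mulr1.
  by rewrite rmorph_nat.
move=> P /Ggen[c ->]; rewrite mulr_sumr; apply: is_ideal_sum => // i _.
rewrite mulrCA; apply: (HM).
have EG k : \sum_l E k l * G l = \det A * G k - t * \sum_l M k l * G l.
  under eq_bigr => l _ do rewrite mxE mulrBl -!mulrA.
  rewrite sumrB /= mulr_sumr; congr (_ - _).
  rewrite (bigD1 k) //= eqxx mul1r big1 ?addr0 // => l.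
  by rewrite eq_sym => /negbTE ->; rewrite mul0r.
by rewrite (cramer EG); apply: is_ideal_sum => // k _; apply: HM.
Qed.

Definition newton_jac : {mpoly K[N.+1]} :=
  \det (\matrix_(i < N, j < N) mderiv (lift ord_max j) (newton_eq i)).

Lemma newton_jac0 : meval (fun=> 0) newton_jac = 1.
Proof.
rewrite -det_map_mx -[RHS](det1 K N); congr (\det _); apply/matrixP => i j.
rewrite !mxE /= /newton_eq !mderivD mderivM !mevalD !mevalM mevalXv mul0r addr0.
rewrite !mderiv_var (inj_eq lift_inj) (negbTE (neq_lift _ _)) meval0 mul0r addr0.
rewrite (raddf_sum (mderiv _)) (raddf_sum (meval _)) /= big1 ?addr0 ?rmorph_nat //.
by move=> l _; rewrite mderivM mevalD !mevalM C0 mevalXv mulr0 mul0r addr0.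
Qed.

End Newton.

(** * The smooth algebra attached to a Newton branch *)

Section NewtonAlgebra.
Variables (K : fieldType) (N : nat).
Variables (B : 'I_N -> {mpoly K[N.+1]}) (C : 'I_N -> 'I_N -> {mpoly K[N.+1]}).
Hypothesis C0 : forall i j, meval (fun=> 0) (C i j) = 0.

Let H := newton_eq B C.
Let z := newton_branch B C.
Let zc : coherent z := newton_branch_coherent B C0.

(* A variable [w] is inserted just before the last one, so that [widen_ord]
   reaches all variables but the parameter of the branch. *)
Let w : 'I_N.+2 := widen_ord (leqnSn N.+1) ord_max.

Definition insert_var : {mpoly K[N.+1]} -> {mpoly K[N.+2]} :=
  mmap (@mpolyC N.+2 K) (fun i => MX (lift w i)).
HB.instance Definition _ := GRing.RMorphism.on insert_var.

Lemma insert_varC c : insert_var (MC c) = MC c.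
Proof. exact: mmapC. Qed.

Lemma insert_varX i : insert_var (MX i) = MX (lift w i).
Proof. exact: mmapXU. Qed.

Lemma mderiv_insert_var i P : mderiv (lift w i) (insert_var P) = insert_var (mderiv i P).
Proof.
elim/mpoly_ring_ind: P => [c|l|p q ep eq|p q ep eq].
- by rewrite insert_varC !mderivC rmorph0.
- by rewrite insert_varX !mderiv_var (inj_eq lift_inj) rmorph_nat.
- by rewrite rmorphD /= !mderivD ep eq rmorphD.
- by rewrite rmorphM /= !mderivM ep eq rmorphD !rmorphM.
Qed.

Lemma mderiv_insert_var0 P : mderiv w (insert_var P) = 0.
Proof.
elim/mpoly_ring_ind: P => [c|l|p q ep eq|p q ep eq].
- by rewrite insert_varC mderivC.
- by rewrite insert_varX mderiv_var eq_sym (negbTE (neq_lift _ _)).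
- by rewrite rmorphD /= mderivD ep eq addr0.
- by rewrite rmorphM /= mderivM ep eq mulr0 mul0r addr0.
Qed.

(** [Q] is generated by the branch and a variable [w] with [w * e = 1]; [eps] is evaluation at
    [t = 0], which supplies the smooth rational point. *)
Lemma newton_algebra : exists (Q : comNzRingType) (iota : {rmorphism K -> Q})
    (x : 'I_N.+1 -> Q) (eps : {rmorphism Q -> K}),
  [/\ standard_smooth iota, no_zero_divisors Q, geometric_domain iota &
   [/\ forall i, mmap iota x (H i) = 0, forall c, x ord_max <> iota c &
       forall c, eps (iota c) = c]].
Proof.
have [g [g0 gH]] := newton_kernel B C0.
set J := newton_jac B C.
(* The factor [g] serves to find the relations, the factor [J] to invert the Jacobian. *)
have [e eE] : {e | e = g * J} by exists (g * J).
have e0 : meval (fun=> 0) e = 1 by rewrite eE mevalM g0 newton_jac0 // mulr1.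
pose ek k := branch_eval z k e.
have eX k : 'X %| 1 - ek k.
  rewrite -[1]/(1%:P) -e0 -mmap_polyC0 -opprB dvdpNr; apply: mmap_dvd => i.
  rewrite subr0 /z /newton_branch /newton_ext.
  by case: (unliftP ord_max i) => [j _|_]; rewrite ?newton_seq_dvdX.
(* Truncated geometric series for the inverse of [e] along the branch. *)
pose wk k := \sum_(l < k.+1) (1 - ek k) ^+ l.
have wke k : 'X^(k.+1) %| ek k * wk k - 1.
  have -> : ek k * wk k - 1 = - (1 - ek k) ^+ k.+1.
    have h : (1 - ek k) ^+ k.+1 - 1 = - (ek k * wk k) by rewrite subrX1 -/(wk k); ring.
    by rewrite -[_ ^+ k.+1](subrK 1) h; ring.
  by rewrite dvdpNr dvdp_exp2r.
pose z2 k m := if unlift w m is Some i then z k i else wk k.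
have z2c : coherent z2.
  move=> k m; rewrite /z2; case: (unliftP w m) => [i _|_]; first exact: zc.
  have -> : wk k.+1 - wk k = wk k * (ek k.+1 * wk k.+1 - 1) - wk k.+1 * (ek k * wk k - 1)
      - wk k.+1 * wk k * (ek k.+1 - ek k) by ring.
  rewrite !dvdp_sub ?dvdp_mull //; last exact: branch_eval_le.
  by apply: dvdp_trans (wke _); rewrite dvdp_exp2l.
have ev2 k P : branch_eval z2 k (insert_var P) = branch_eval z k P.
  apply: (rmorph_mmap (g := branch_eval z2 k)) => [c|i]; first by rewrite /= /branch_eval mmapC.
  by rewrite /= /branch_eval mmapXU /z2 liftK.
have evw k : branch_eval z2 k (MX w) = wk k.
  by rewrite /branch_eval mmapXU /z2 unlift_none.
pose f (l : 'I_N.+1) := if unlift ord_max l is Some i then insert_var (H i)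
  else MX w * insert_var e - 1.
have fH i : f (lift ord_max i) = insert_var (H i) by rewrite /f liftK.
have fw : f ord_max = MX w * insert_var e - 1 by rewrite /f unlift_none.
have [Q [pi [pis piI Qnz Qg]]] := branch_ring z2c.
have pif l : pi (f l) = 0.
  have [i ->|->] := unliftP ord_max l; apply/piI/branch_idealP => k.
    by rewrite fH ev2; apply/branch_idealP/newton_eq_ideal.
  by rewrite fw rmorphB rmorphM rmorph1 /= evw ev2 mulrC.
have iF := gen_ideal_ideal f; have [F0 FD FM] := iF.
have FB := @is_idealB _ _ _ _ iF.
have kerF P : pi P = 0 -> gen_ideal f P.
  (* A power of [e] clears the variable [w] from [P]. The resulting [P0] lies in the branch ideal,
     [g * P0] is a combination of the equations, and finally [w] undoes the powers of [e]. *)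
  have [d [P0 hP]] : exists d P0, gen_ideal f (insert_var e ^+ d * P - insert_var P0).
    elim/mpoly_ring_ind: P => [c|l|p q [a [p0 hp]] [b [q0 hq]]|p q [a [p0 hp]] [b [q0 hq]]].
    - by exists 0%N, (MC c); rewrite expr0 mul1r insert_varC subrr.
    - have [i ->|->] := unliftP w l.
        by exists 0%N, (MX i); rewrite expr0 mul1r insert_varX subrr.
      exists 1%N, 1; rewrite rmorph1 expr1 mulrC -fw; exact: gen_ideal_gen.
    - exists (a + b)%N, (e ^+ b * p0 + e ^+ a * q0).
      rewrite rmorphD !rmorphM !rmorphXn /=.
      have := FD _ _ (FM (insert_var e ^+ b) _ hp) (FM (insert_var e ^+ a) _ hq).
      by congr gen_ideal; rewrite exprD; ring.
    - exists (a + b)%N, (p0 * q0); rewrite rmorphM /=.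
      have := FD _ _ (FM (insert_var e ^+ b * q) _ hp) (FM (insert_var p0) _ hq).
      by congr gen_ideal; rewrite exprD; ring.
  move=> piP.
  have P0I : P0 \in branch_ideal z.
    have /piI/branch_idealP PI : pi (insert_var P0) = 0.
      have : pi (insert_var e ^+ d * P - insert_var P0) = 0.
        by case: hP => c ->; rewrite rmorph_sum big1 // => i _; rewrite rmorphM pif mulr0.
      by rewrite rmorphB rmorphM piP mulr0 sub0r => /eqP; rewrite oppr_eq0 => /eqP.
    by apply/branch_idealP => k; rewrite -ev2.
  have gP0 : gen_ideal f (insert_var (g * P0)).
    have [c ->] := gH _ P0I; rewrite rmorph_sum; apply: is_ideal_sum => // i _.
    by rewrite rmorphM /= -fH; apply: FM; apply: gen_ideal_gen.
  have eP : gen_ideal f (insert_var e ^+ d.+1 * P).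
    have := FD _ _ (FM (insert_var e) _ hP) (FM (insert_var J) _ gP0).
    by congr gen_ideal; rewrite eE !rmorphM /= exprS; ring.
  have := FB _ _ (FM (MX w ^+ d.+1) _ eP) (FM (P * \sum_(i < d.+1) (MX w * insert_var e) ^+ i) _
    (gen_ideal_gen f ord_max)).
  congr gen_ideal; rewrite fw mulrA -exprMn -mulrA [_ * (_ - 1)]mulrC -subrX1; ring.
pose iota : {rmorphism K -> Q} := (pi \o @mpolyC N.+2 K : {rmorphism _ -> _}).
have mmapE (n' : nat) (h : 'I_n' -> {mpoly K[N.+2]}) P :
    mmap iota (fun i => pi (h i)) P = pi (mmap (@mpolyC N.+2 K) h P).
  by symmetry; apply: rmorph_mmap.
have mmap_id P : mmap iota (fun i => pi (MX i)) P = pi P.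
  rewrite mmapE; congr (pi _); elim/mpoly_ring_ind: P => [c|l|p q ep eq|p q ep eq].
  - exact: mmapC.
  - exact: mmapXU.
  - by rewrite rmorphD /= ep eq.
  - by rewrite rmorphM /= ep eq.
have piw : pi (MX w) * pi (insert_var e) = 1.
  by apply/eqP; rewrite -rmorphM -subr_eq0 -[1](rmorph1 pi) -rmorphB -fw pif.
have epsI P : pi P = 0 -> (branch_eval z2 0 P).[0] = 0.
  move=> /piI/branch_idealP/(_ 0%N); rewrite expr1 => /dvdpP[q ->].
  by rewrite hornerM hornerX mulr0.
have [eps epsE] := rmorph_factor (g := horner_eval 0 \o branch_eval z2 0 : {rmorphism _ -> _})
  pis epsI.
exists Q, iota, (fun i => pi (MX (lift w i))), eps; split=> //; last split.
- exists N.+2, N.+1, (leqnSn _), (fun i => pi (MX i)), f; split.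
  + by move=> a; have [P <-] := pis a; exists P.
  + move=> P; rewrite mmap_id; split; first by move/kerF => [c ->]; exists c.
    by move=> [c ->]; rewrite rmorph_sum big1 // => i _; rewrite rmorphM /= pif mulr0.
  (* In the column of [w] only the derivative [e] of the last equation survives, so the determinant
     is [e * J]; multiplied by [w ^+ 2 * g] it becomes [(w * e) ^+ 2 = 1]. *)
  exists (pi (MX w) ^+ 2 * pi (insert_var g)).
  set D := \matrix_(i, j) _.
  have -> : D = map_mx pi (\matrix_(i < N.+1, j < N.+1) mderiv (widen_ord (leqnSn _) j) (f i)).
    by apply/matrixP => i j; rewrite !mxE mmap_id.
  rewrite det_map_mx (expand_det_col _ ord_max) (bigD1 ord_max) //= big1 ?addr0; last first.
    move=> l; have [i ->|->] := unliftP ord_max l; last by rewrite eqxx.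
    by move=> _; rewrite mxE fH mderiv_insert_var0 mul0r.
  rewrite mxE fw mderivB mderivM mderiv_insert_var0 mulr0 addr0 mderiv_var eqxx mul1r.
  rewrite -mpolyC1 mderivC subr0 /cofactor /= -signr_odd oddD addbb expr0 mul1r.
  have -> : row' ord_max (col' ord_max
      (\matrix_(i < N.+1, j < N.+1) mderiv (widen_ord (leqnSn _) j) (f i))) =
      map_mx insert_var (\matrix_(i, j) mderiv (lift ord_max j) (H i)).
    apply/matrixP => i j; rewrite !mxE fH -mderiv_insert_var; congr (mderiv _ _).
    have bj : bump N j = j by rewrite /bump leqNgt ltn_ord.
    by apply: val_inj; rewrite /= !bj.
  rewrite det_map_mx rmorphM -/J.
  transitivity ((pi (MX w) * pi (insert_var e)) ^+ 2); last by rewrite piw expr1n.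
  by rewrite eE !rmorphM /=; ring.
- move=> i; rewrite mmapE; apply: etrans (pif (lift ord_max i)); by rewrite fH.
(* Level [1] is the first that sees the coefficient of degree one, which is [1] in [t - c]. *)
- move=> c /eqP; rewrite -subr_eq0 -rmorphB => /eqP /piI /branch_idealP /(_ 1%N).
  rewrite rmorphB /= /branch_eval mmapC mmapXU /z2 liftK /z /newton_branch /newton_ext unlift_none.
  by move=> /dvdXnP /(_ 1%N isT) /eqP; rewrite coefB coefX coefC subr0 oner_eq0.
- by move=> c; rewrite epsE /= /branch_eval mmapC /horner_eval hornerC.
Qed.

End NewtonAlgebra.

(** * Affine schemes *)

Local Open Scope classical_set_scope.
Local Open Scope ring_scope.
Local Notation frac := Defs.frac.

Lemma rmorph_eq (R S : comPzRingType) (f g : {rmorphism R -> S}) : f =1 g -> f = g.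
Proof.
case: f g => [f [[fa] [fm]]] [g [[ga] [gm]]] /= /funext e.
case: _ / e in ga gm *.
by rewrite (Prop_irrelevance fa ga) (Prop_irrelevance fm gm).
Qed.

Lemma bij_rmorph_inv (R S : comPzRingType) (f : {rmorphism R -> S}) :
  bijective f -> exists g : {rmorphism S -> R}, cancel f g /\ cancel g f.
Proof.
move=> [h fK hK]; have [|x|g gE] := @rmorph_factor R S R f (idfun : {rmorphism _ -> _}).
- by move=> y; exists (h y).
- by move=> /(congr1 h); rewrite fK -(rmorph0 f) fK.
by exists g; split=> x; [exact: gE|rewrite -(hK x) gE].
Qed.

Section PrimeAvoidance.
Variables (A : comNzRingType) (I : A -> Prop) (S : A -> Prop).
Hypotheses (iI : is_ideal I) (S1 : S 1) (SM : forall x y, S x -> S y -> S (x * y)).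
Hypothesis IS : forall x, I x -> ~ S x.

Lemma prime_avoiding : exists p : spec_pt A,
  (forall x, I x -> x \in p) /\ (forall x, S x -> x \notin p).
Proof.
pose good (J : set A) := [/\ is_ideal J, I `<=` J & forall x, J x -> ~ S x].
have chain (F : set (set A)) : F `<=` [set J | J = set0 \/ good J] -> total_on F subset ->
    \bigcup_(X in F) X = set0 \/ good (\bigcup_(X in F) X).
  move=> Fg Ft; have [[J FJ gJ]|nF] := pselect (exists2 J, F J & good J); last first.
    left; rewrite -subset0 => x [J FJ Jx]; case: (Fg J FJ) => [J0|gJ]; first by rewrite J0 in Jx.
    by case: nF; exists J.
  have goodF X x : F X -> X x -> good X.
    by move=> FX Xx; case: (Fg X FX) => // X0; rewrite X0 in Xx.
  right; split=> [|x Ix|x [X FX Xx]]; last by case: (goodF X x FX Xx) => _ _; apply.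
    split=> [|x y [X FX Xx] [Y FY Yy]|a x [X FX Xx]].
    - by exists J => //; case: gJ => [[]].
    - have [XY|YX] := Ft X Y FX FY.
        by exists Y => //; have [[_ YD _] _ _] := goodF Y y FY Yy; apply: YD => //; apply: XY.
      by exists X => //; have [[_ XD _] _ _] := goodF X x FX Xx; apply: XD => //; apply: YX.
    - by exists X => //; have [[_ _ XM] _ _] := goodF X x FX Xx; apply: XM.
  by exists J => //; case: gJ => _ + _; apply.
have [P [gP maxP]] := Zorn_bigcup chain.
have {}gP : good P.
  case: gP => // P0; case: (maxP I); last by right; split.
  by rewrite P0; split; [exact: sub0set|move=> /(_ 0)]; case: iI => I0 _ _ /(_ I0).
have [[P0 PD PM] IP PS] := gP.
have ext x : ~ P x -> exists a y, P y /\ S (a * x + y).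
  move=> nPx; apply: contrapT => nS.
  case: (maxP [set u | exists a y, P y /\ u = a * x + y]).
    split=> [y Py|h]; first by exists 0, y; rewrite mul0r add0r.
    by apply: nPx; apply: h; exists 1, 0; rewrite mul1r addr0.
  right; split=> [|y /IP Py|u [a [y [Py ->]]] Su]; last by apply: nS; exists a, y.
    split=> [|u v [a [y [Py ->]]] [b [z [Pz ->]]]|b u [a [y [Py ->]]]].
    - by exists 0, 0; rewrite mul0r addr0.
    - by exists (a + b), (y + z); rewrite mulrDl addrACA; split=> //; apply: PD.
    - by exists (b * a), (b * y); rewrite mulrDr mulrA; split=> //; apply: PM.
  by exists 0, y; rewrite mul0r add0r.
pose pr : A -> bool := fun x => `[< P x >].
have prE x : (x \in pr) = `[< P x >] by [].
have pr_ideal : idealr_closed pr.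
  split=> [||a x y]; rewrite !prE; first exact/asboolP.
    by apply/asboolP => /PS.
  by move=> /asboolP Px /asboolP Py; apply/asboolP; apply: PD => //; apply: PM.
have pr_prime : prime_idealr_closed pr.
  move=> x y; rewrite !prE => /asboolP Pxy; apply: contrapT => /negP.
  rewrite negb_or => /andP[/asboolP/ext[a [u [Pu Sa]]] /asboolP/ext[b [v [Pv Sb]]]].
  apply: PS (SM Sa Sb).
  have -> : (a * x + u) * (b * y + v) = a * b * (x * y) + (b * y + v) * u + a * x * v by ring.
  by apply: (PD); [apply: (PD)|]; apply: PM.
exists (SpecPt pr_ideal pr_prime); split=> x; first by move=> /IP Px; apply/asboolP.
by move=> Sx; apply/asboolP => /PS.
Qed.

End PrimeAvoidance.

(** * Global sections of the structure sheaf of an affine scheme *)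

Section AffineSections.
Variable A : comNzRingType.
Implicit Types (U V : opens (spec_pt A)) (p q : spec_pt A).

(** Quasi-compactness in algebraic form: if the [x] for which a property holds on the basic open set
    of [x] form an ideal, a local check makes it global. *)
Lemma ideal_unit (I : A -> Prop) : is_ideal I ->
  (forall p, exists2 x, I x & x \notin p) -> I 1.
Proof.
move=> iI Ip; apply: contrapT => nI1.
have [||||p [Isub _]] := @prime_avoiding A I (fun x => x = 1) => //.
- by move=> x y -> ->; rewrite mul1r.
- by move=> x Ix x1; rewrite x1 in Ix.
by have [x /Isub ->] := Ip p.
Qed.

(** Otherwise the annihilator of [a] misses the powers of [e], and a prime containing the former and
    avoiding the latter is a point where [a] does not vanish. *)
Lemma frac_zero (a e : A) :
  (forall p, e \notin p -> frac a (prime_notin1 p) = 0) -> exists N, e ^+ N * a = 0.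
Proof.
move=> ae; apply: contrapT => ne.
have [||x y [m ->] [n ->]|x xa [m xe]|p [annp ep]] := @prime_avoiding A (fun x => x * a = 0)
    (fun x => exists N, x = e ^+ N).
- split=> [|x y xa ya|b x xa]; first by rewrite mul0r.
  + by rewrite mulrDl xa ya addr0.
  + by rewrite -mulrA xa mulr0.
- by exists 0%N.
- by exists (m + n)%N; rewrite exprD.
- by apply: ne; exists m; rewrite -xe.
have /ae : e \notin p by apply: ep; exists 1%N; rewrite expr1.
rewrite frac0 => /frac_eq[u up]; rewrite mulr1 mul0r subr0 => /annp.
by rewrite (negbTE up).
Qed.

Lemma section_cst_zmod U : zmod_morphism (section_cst U).
Proof.
move=> a b; apply: spec_sectionP => p /=; rewrite fracN fracD.
by apply: frac_eq1; ring.
Qed.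

Lemma section_cst_monoid U : monoid_morphism (section_cst U).
Proof.
split=> [|a b]; apply: spec_sectionP => p //=; rewrite fracM.
by apply: frac_eq1; ring.
Qed.

HB.instance Definition _ U := GRing.isZmodMorphism.Build A (spec_section U)
  (section_cst U) (section_cst_zmod U).
HB.instance Definition _ U := GRing.isMonoidMorphism.Build A (spec_section U)
  (section_cst U) (section_cst_monoid U).

Definition spec_cst U : {rmorphism A -> sections (Spec A) U} := section_cst U.

Lemma res_cst U V (VU : V `<=` U) a : res (X := Spec A) VU (spec_cst U a) = spec_cst V a.
Proof. exact: spec_sectionP. Qed.

Lemma open_basic U p : oset U p ->
  exists2 g, g \notin p & forall q, g \notin q -> oset U q.
Proof.
have [S _ SU] := oset_open U; rewrite -SU => -[g Sg gp].
by exists g => // q gq; exists g.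
Qed.

Lemma germ_basic U (s : spec_section U) p (Up : oset U p) :
  exists g a f, g \notin p /\ forall q (Uq : oset U q), g \notin q ->
    exists fq : f \notin q, s (exist _ q Uq) = frac a fq.
Proof.
have [V [Vp [a [f sV]]]] := germ_ofP s Up; have [g gp gV] := open_basic Vp.
by exists g, a, f; split=> // q Uq /gV Vq; apply: sV.
Qed.

Lemma frac_mulK (a f : A) p (fp : f \notin p) :
  frac f (prime_notin1 p) * frac a fp = frac a (prime_notin1 p).
Proof. by rewrite fracM; apply: frac_eq1; ring. Qed.

Lemma frac_mulI (f : A) p (fp : f \notin p) (x y : loc p) :
  frac f (prime_notin1 p) * x = frac f (prime_notin1 p) * y -> x = y.
Proof.
have inv : frac 1 fp * frac f (prime_notin1 p) = 1.
  by rewrite fracM frac1; apply: frac_eq1; ring.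
by move=> /(congr1 (fun z => frac 1 fp * z)); rewrite !mulrA inv !mul1r.
Qed.

Section FullOpen.
Variable U : opens (spec_pt A).
Hypothesis Ufull : forall p, oset U p.

Let germ (s : spec_section U) p : loc p := s (exist _ p (Ufull p)).

Let germ_ext s t : (forall p, germ s p = germ t p) -> s = t.
Proof.
by move=> st; apply: spec_sectionP => -[p Up]; rewrite (Prop_irrelevance Up (Ufull p)); apply: st.
Qed.

Let germ_cst a p : germ (section_cst U a) p = frac a (prime_notin1 p). Proof. by []. Qed.
Let germM s t p : germ (s * t) p = germ s p * germ t p. Proof. by []. Qed.
Let germB s t p : germ (s - t) p = germ s p - germ t p. Proof. by []. Qed.

Lemma section_zero_on (s : spec_section U) (g : A) :
  (forall p, g \notin p -> germ s p = 0) -> exists N, section_cst U (g ^+ N) * s = 0.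
Proof.
move=> sg.
pose I h := exists N, forall p, h \notin p -> germ (section_cst U (g ^+ N) * s) p = 0.
have widen N M p : germ (section_cst U (g ^+ N) * s) p = 0 ->
    germ (section_cst U (g ^+ (N + M)) * s) p = 0.
  move=> e; have -> : section_cst U (g ^+ (N + M)) * s =
      section_cst U (g ^+ M) * (section_cst U (g ^+ N) * s).
    by rewrite exprD [g ^+ N * _]mulrC rmorphM -mulrA.
  by rewrite [LHS]germM e mulr0.
have [||N e] := @ideal_unit I; last 1 first.
- by exists N; apply: germ_ext => p; rewrite e // prime_notin1.
- split=> [|x y [N xN] [M yM]|a x [N xN]].
  + by exists 0%N => p; rewrite rpred0.
  + exists (N + M)%N => p xyp; have [xp|xp] := boolP (x \in p).
      by rewrite addnC; apply/widen/yM; apply: contra xyp => yp; rewrite rpredD.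
    exact/widen/xN.
  + by exists N => p axp; apply: xN; move: axp; rewrite mulrC; apply: prime_notinMl.
move=> p; have [h [a [f [hp sh]]]] := germ_basic s (Ufull p).
have [|N gha] := @frac_zero a (g * h).
  move=> q ghq; have gq := prime_notinMl ghq.
  have hq : h \notin q by move: ghq; rewrite mulrC; apply: prime_notinMl.
  have [fq sq] := sh q (Ufull q) hq; rewrite -(frac_mulK a fq) -sq -/(germ s q) sg //.
  by rewrite mulr0.
exists h => //; exists N => q hq; have [fq sq] := sh q (Ufull q) hq.
rewrite germM germ_cst [germ s q]sq fracM frac0; apply/frac_eq; exists (h ^+ N).
  by elim: N {gha} => [|n IH]; rewrite ?expr0 ?prime_notin1 // exprS prime_notinM.
by rewrite mulr1 mul0r subr0 mulrA [h ^+ N * _]mulrC -exprMn.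
Qed.

(** Surjectivity: the denominators [b] with [b * s] constant form an ideal. Where [s] is [a / f] on
    the basic open set of [g], [section_zero_on] puts some [g ^+ N * f] into it. An arbitrary [U]
    containing all points is allowed, since preimages of charts come in this form. *)
Lemma spec_cst_bij : bijective (spec_cst U).
Proof.
have inj : injective (spec_cst U).
  move=> a b ab; apply/eqP; rewrite -subr_eq0; apply/eqP.
  have [|N] := @frac_zero (a - b) 1; last by rewrite expr1n mul1r.
  move=> p _; rewrite -germ_cst; move: ab => /eqP; rewrite -subr_eq0 => /eqP ab.
  by rewrite -/(spec_cst U (a - b)) rmorphB ab.
suff surj s : exists b, spec_cst U b = s.
  have [h hK] := choice surj; exists h => // a.
  by apply: inj; rewrite hK.
pose I b := exists a, section_cst U b * s = section_cst U a.
have [||a] := @ideal_unit I; last 1 first.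
- by rewrite rmorph1 mul1r => ->; exists a.
- split=> [|x y [a xa] [b yb]|b x [a xa]].
  + by exists 0; rewrite !rmorph0 mul0r.
  + by exists (a + b); rewrite !rmorphD mulrDl xa yb.
  + by exists (b * a); rewrite !rmorphM -mulrA xa.
move=> p; have [g [a [f [gp sg]]]] := germ_basic s (Ufull p).
have [fp _] := sg p (Ufull p) gp.
have [|N e] := @section_zero_on (section_cst U f * s - section_cst U a) g.
  move=> q gq; have [fq sq] := sg q (Ufull q) gq.
  by rewrite germB germM !germ_cst [germ s q]sq frac_mulK subrr.
exists (g ^+ N * f).
  exists (g ^+ N * a); rewrite !rmorphM; apply/eqP.
  by rewrite -subr_eq0 -mulrA -mulrBr e.
apply: prime_notinM => //; elim: N {e} => [|n IH]; rewrite ?expr0 ?prime_notin1 //.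
by rewrite exprS prime_notinM.
Qed.

End FullOpen.

End AffineSections.

(** The sections compared live over different open sets as long as [f] and [g] are not identified,
    hence the restriction to a common [W]. *)
Lemma rs_hom_ext (X Y : ringed_space) (f g : rs_hom X Y) :
  (forall x, f x = g x) ->
  (forall (U : opens Y) (s : sections Y U) (W : opens X)
      (Wf : W `<=` hom_preim f U) (Wg : W `<=` hom_preim g U),
    res Wf (hom_sec f U s) = res Wg (hom_sec g U s)) -> f = g.
Proof.
case: f => f fo fs fr fl; case: g => g go gs gr gl /= /funext e.
case: _ / e in go gs gr gl *; have eo := Prop_irrelevance fo go.
case: _ / eo in gs gr gl * => fg.
have es : fs = gs.
  apply: functional_extensionality_dep => U; apply: rmorph_eq => s.
  have WW : opens_preim fo U `<=` opens_preim fo U by [].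
  by have := fg U s _ WW WW; rewrite /= !res_id.
case: _ / es in gr gl fg *.
by rewrite (Prop_irrelevance gr fr) (Prop_irrelevance gl fl).
Qed.

Lemma rs_comp_idr (X Y : ringed_space) (f : rs_hom X Y) : rs_comp f (rs_id X) = f.
Proof. by apply: rs_hom_ext => // U s W Wf Wg /=; rewrite (Prop_irrelevance Wf Wg). Qed.

Lemma rs_comp_idl (X Y : ringed_space) (f : rs_hom X Y) : rs_comp (rs_id Y) f = f.
Proof. by apply: rs_hom_ext => // U s W Wf Wg /=; rewrite (Prop_irrelevance Wf Wg). Qed.

Lemma rs_compA (X Y Z T : ringed_space) (f : rs_hom Z T) (g : rs_hom Y Z) (h : rs_hom X Y) :
  rs_comp f (rs_comp g h) = rs_comp (rs_comp f g) h.
Proof. by apply: rs_hom_ext => // U s W Wf Wg /=; rewrite (Prop_irrelevance Wf Wg). Qed.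

Lemma germ_unit_pull (X Y : ringed_space) (f : rs_hom X Y) (U : opens Y)
    (s : sections Y U) (x : X) :
  germ_unit s (f x) -> germ_unit (hom_sec f U s) x.
Proof.
move=> [V [VU [Vx [t st]]]]; have VU' : hom_preim f V `<=` hom_preim f U by move=> y; apply: VU.
exists (hom_preim f V), VU'; split=> //; exists (hom_sec f V t).
by rewrite (hom_res VU VU') -rmorphM st rmorph1.
Qed.

Lemma spec_pt_ext (A : comNzRingType) (p q : spec_pt A) :
  (forall a, (a \in p) = (a \in q)) -> p = q.
Proof.
case: p q => [p pI pP] [q qI qP] pq.
have e : p = q by apply: funext => a; exact: pq.
case: _ / e in qI qP pq *.
by rewrite (Prop_irrelevance pI qI) (Prop_irrelevance pP qP).
Qed.

Lemma germ_unit_cst (A : comNzRingType) (U : opens (Spec A)) (a : A) (p : Spec A) :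
  oset U p -> germ_unit (spec_cst U a) p <-> a \notin (p : spec_pt A).
Proof.
move=> Up; split=> [[V [VU [Vp [t]]]]|ap].
  rewrite res_cst => /(congr1 (fun r : spec_section V => r (exist _ p Vp))) /=.
  have [b [g [gp ->]]] := locP (t (exist _ p Vp)).
  rewrite fracM => /frac_eq[u up]; rewrite mulr1 !mul1r => /eqP.
  rewrite mulrBr subr_eq0 => /eqP e; apply: contraNN gp => ap.
  have : u * g \in (p : spec_pt A) by rewrite -e [a * b]mulrC mulrA idealMr.
  by rewrite prime_idealrM (negbTE up).
have oD : open (primes_outside [set a]) by exists [set a].
pose V := Opens (openI (oset_open U) oD : open (oset U `&` primes_outside [set a])).
have VU : V `<=` U by move=> q [].
have aV (q : {q : spec_pt A | oset V q}) : a \notin sval q.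
  by have [_ [b ba bp]] := proj2_sig q; rewrite -(ba : b = a).
pose t0 : germs V := fun q => frac 1 (aV q).
have t0P : locally_frac t0.
  by move=> q Vq; exists V; split=> //; exists 1, a => r Vr _; exists (aV (exist _ r Vr)).
exists V, VU; split; first by split=> //; exists a.
exists (SpecSection t0P); rewrite res_cst; apply: spec_sectionP => q /=.
by rewrite fracM; apply: frac_eq1; ring.
Qed.

(** * Morphisms between affine schemes are ring homomorphisms *)

Section AffineHom.
Variables A B : comNzRingType.
Implicit Types (h : rs_hom (Spec B) (Spec A)) (phi : {rmorphism A -> B}).

Definition pulls_back h phi := forall (U : opens (Spec A)) (a : A),
  hom_sec h U (spec_cst U a) = spec_cst (hom_preim h U) (phi a).

Lemma ex_pulls_back h : exists phi, pulls_back h phi.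
Proof.
pose U0 : opens (Spec A) := Opens openT.
have [g [_ gK]] : exists g : {rmorphism sections (Spec B) (hom_preim h U0) -> B},
    cancel (spec_cst (hom_preim h U0)) g /\ cancel g (spec_cst (hom_preim h U0)).
  exact/bij_rmorph_inv/spec_cst_bij.
exists (g \o (hom_sec h U0 \o spec_cst U0) : {rmorphism _ -> _}) => U a /=.
have UU0 : U `<=` U0 by [].
have UU0' : hom_preim h U `<=` hom_preim h U0 by [].
rewrite -(res_cst UU0 a) -(hom_res UU0 UU0').
by rewrite -(res_cst (UU0' : oset _ `<=` oset _)) gK.
Qed.

Lemma Spec_map_pulls phi : pulls_back (Spec_map phi) phi.
Proof.
move=> U a; apply: spec_sectionP => q /=; rewrite /spec_pull_germs /= loc_mapE.
by apply: frac_eq1; rewrite rmorph1.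
Qed.

(** Locality of [h] enters here: [a] avoids a prime exactly when its germ there is a unit, and [h]
    preserves and reflects units of stalks. *)
Lemma pulls_back_mem h phi (q : Spec B) a : pulls_back h phi ->
  (a \in (h q : spec_pt A)) = (phi a \in (q : spec_pt B)).
Proof.
move=> hphi; apply: negb_inj; pose U0 : opens (Spec A) := Opens openT.
have hu : germ_unit (hom_sec h U0 (spec_cst U0 a)) q <-> phi a \notin (q : spec_pt B).
  by rewrite hphi; apply: germ_unit_cst.
apply/idP/idP.
  by move/(@germ_unit_cst _ U0 a (h q) I)/germ_unit_pull/hu.
by move/hu/(hom_local (U := U0)) => /(_ I)/germ_unit_cst; apply.
Qed.

Lemma pulls_back_germ h phi (U V : opens (Spec A)) (VU : V `<=` U)
    (s : sections (Spec A) U) (a f : A) (q : Spec B) (Uq : oset (hom_preim h U) q) :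
  pulls_back h phi -> spec_cst V f * res VU s = spec_cst V a -> oset V (h q) ->
  frac (phi f) (prime_notin1 q) * (hom_sec h U s : spec_section _) (exist _ q Uq) =
  frac (phi a) (prime_notin1 q).
Proof.
move=> hphi /(congr1 (hom_sec h V)) + Vq; rewrite rmorphM !hphi.
have VU' : hom_preim h V `<=` hom_preim h U by move=> r; apply: VU.
rewrite -(hom_res VU VU').
move=> /(congr1 (fun r : spec_section (hom_preim h V) => r (exist _ q Vq))) /= <-.
by congr (_ * _); apply: germs_irrelevance.
Qed.

Lemma pulls_back_inj h h' phi : pulls_back h phi -> pulls_back h' phi -> h = h'.
Proof.
move=> hp hp'; have hh' q : h q = h' q.
  by apply: spec_pt_ext => a; rewrite (pulls_back_mem _ _ hp) (pulls_back_mem _ _ hp').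
apply: rs_hom_ext => // U s W Wh Wh'; apply: spec_sectionP => -[q Wq].
rewrite /= /restrict_germs /=.
have [g [a [f [gp sg]]]] := germ_basic (s : spec_section U) (Wh q Wq).
have oD : open (primes_outside [set g]) by exists [set g].
pose V : opens (Spec A) :=
    Opens (openI (oset_open U) oD : open (oset U `&` primes_outside [set g])).
have VU : V `<=` U by move=> r [].
have Vq : oset V (h q) by split; [exact: Wh|exists g].
have sV : spec_cst V f * res VU s = spec_cst V a.
  apply: spec_sectionP => -[r Vr] /=; have [Ur [g' g'E]] := Vr.
  rewrite (g'E : g' = g) => gr.
  rewrite /restrict_germs (germs_irrelevance s _ Ur).
  by have [fr ->] := sg r Ur gr; apply: frac_mulK.
have fq : phi f \notin (q : spec_pt B).
  by rewrite -(pulls_back_mem _ _ hp); have [] := sg _ (Wh q Wq) gp.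
apply: (frac_mulI fq).
rewrite (pulls_back_germ (Wh q Wq) hp sV Vq).
by rewrite (pulls_back_germ (Wh' q Wq) hp' sV) // -hh'.
Qed.

Lemma affine_hom h : exists phi, h = Spec_map phi.
Proof.
have [phi hphi] := ex_pulls_back h; exists phi.
exact: pulls_back_inj hphi (@Spec_map_pulls phi).
Qed.

Lemma spec_cst_inj (U : opens (Spec A)) : (forall p, oset U p) -> injective (spec_cst U).
Proof. by move=> Uf; apply/bij_inj/spec_cst_bij. Qed.

End AffineHom.

Lemma Spec_map_inj (A B : comNzRingType) (phi psi : {rmorphism A -> B}) :
  Spec_map phi = Spec_map psi -> phi =1 psi.
Proof.
move=> e a; pose U0 : opens (Spec A) := Opens openT.
apply: (@spec_cst_inj B (hom_preim (Spec_map phi) U0)) => //.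
have := @Spec_map_pulls _ _ psi U0 a; rewrite -e.
by rewrite Spec_map_pulls.
Qed.

Lemma Spec_map_comp (A B C : comNzRingType) (phi : {rmorphism A -> B})
    (psi : {rmorphism B -> C}) (chi : {rmorphism A -> C}) :
  (forall a, psi (phi a) = chi a) ->
  rs_comp (Spec_map phi) (Spec_map psi) = Spec_map chi.
Proof.
move=> e; apply: (@pulls_back_inj _ _ _ _ chi); last exact: Spec_map_pulls.
move=> U a; rewrite -e.
apply: etrans (@Spec_map_pulls _ _ psi (hom_preim (Spec_map phi) U) (phi a)).
exact: (congr1 (hom_sec (Spec_map psi) (hom_preim (Spec_map phi) U))
  (@Spec_map_pulls _ _ phi U a)).
Qed.

Lemma Spec_map_id (A : comNzRingType) : Spec_map (idfun : {rmorphism A -> A}) = rs_id (Spec A).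
Proof.
apply: (@pulls_back_inj _ _ _ _ idfun); first exact: Spec_map_pulls.
by move=> U a.
Qed.

(** * Integral schemes *)

Lemma section_eq0_local (X : ringed_space) (U : opens X) (s : sections X U) :
  (forall x, oset U x -> exists (V : opens X) (VU : V `<=` U), oset V x /\ res VU s = 0) ->
  s = 0.
Proof.
move=> loc0; pose I := {x | oset U x}.
have /choice[V VP] (i : I) : exists V : opens X, oset V (sval i) /\
    exists VU : V `<=` U, res VU s = 0.
  by have [V [VU [Vx s0]]] := loc0 _ (svalP i); exists V; split=> //; exists VU.
have VU i : V i `<=` U by have [_ []] := VP i.
apply: (sheaf_separated (V := V) (VU := VU)) => [x Ux|i].
  by exists (exist _ x Ux) => //; have [] := VP (exist _ x Ux).
by rewrite rmorph0; have [_ [VU' <-]] := VP i; rewrite (Prop_irrelevance (VU i) VU').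
Qed.

Section GenericPoint.
Variable R : comNzRingType.
Hypothesis Rnz : no_zero_divisors R.

Definition zero_ideal : R -> bool := fun x => x == 0.

Lemma zero_ideal_closed : idealr_closed zero_ideal.
Proof.
have zE x : (x \in zero_ideal) = (x == 0) by [].
split=> [||a x y]; rewrite !zE ?eqxx ?oner_eq0 //.
by move=> /eqP -> /eqP ->; rewrite mulr0 addr0.
Qed.

Lemma zero_ideal_prime : prime_idealr_closed zero_ideal.
Proof.
move=> x y; have zE z : (z \in zero_ideal) = (z == 0) by [].
by rewrite !zE => /eqP/Rnz[->|->]; rewrite eqxx ?orbT.
Qed.

Definition generic_pt : spec_pt R := SpecPt zero_ideal_closed zero_ideal_prime.

Lemma generic_ptE x : (x \in generic_pt) = (x == 0). Proof. by []. Qed.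

Lemma generic_pt_open (U : opens (spec_pt R)) p : oset U p -> oset U generic_pt.
Proof.
move=> /open_basic[g gp gU]; apply: gU; rewrite generic_ptE.
by apply: contraNneq gp => ->; rewrite rpred0.
Qed.

Lemma germ_generic_eq0 (U : opens (spec_pt R)) (s : spec_section U) (Ue : oset U generic_pt) :
  s (exist _ generic_pt Ue) = 0 -> s = 0.
Proof.
move=> se; apply: spec_sectionP => -[p Up].
have [g [a [f [gp sg]]]] := germ_basic s Up.
have [|fe sa] := sg generic_pt Ue; first by apply: contra gp => /eqP ->; rewrite rpred0.
have a0 : a = 0.
  move: se; rewrite sa frac0 => /frac_eq[u]; rewrite generic_ptE mulr1 mul0r subr0.
  by move=> /eqP u0 /Rnz[].
have [fp ->] := sg p Up gp; rewrite a0 -[RHS]/(0 : loc p) frac0.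
by apply: frac_eq1; rewrite !mul0r.
Qed.

(** Sections over a nonempty open set are determined by their germ at the generic point, where
    fractions multiply without zero divisors. *)
Lemma spec_section_nz (U : opens (Spec R)) : no_zero_divisors (sections (Spec R) U).
Proof.
move=> s t st; have [[p Up]|nU] := pselect (exists p, oset U p); last first.
  by left; apply: spec_sectionP => -[p Up]; case: nU; exists p.
have Ue := generic_pt_open Up.
have /(congr1 (fun r : spec_section U => r (exist _ generic_pt Ue))) /= := st.
have [a [f [fe sa]]] := locP ((s : spec_section U) (exist _ generic_pt Ue)).
have [b [g [ge tb]]] := locP ((t : spec_section U) (exist _ generic_pt Ue)).
rewrite sa tb fracM => /frac_eq[u]; rewrite generic_ptE mulr1 mul0r subr0.
have zz c h (he : h \notin generic_pt) : c = 0 -> frac c he = 0.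
  by move=> ->; rewrite frac0; apply: frac_eq1; rewrite !mul0r.
move=> /eqP u0 /Rnz[//|/Rnz[a0|b0]]; [left|right].
  by apply: (@germ_generic_eq0 U s Ue); rewrite sa zz.
by apply: (@germ_generic_eq0 U t Ue); rewrite tb zz.
Qed.

End GenericPoint.

Lemma spec_section_neq0 (A : comNzRingType) (U : opens (Spec A)) (p : Spec A) :
  oset U p -> (1 : sections (Spec A) U) <> 0.
Proof.
move=> Up /(congr1 (fun r : spec_section U => r (exist _ p Up))) /=.
by move=> e; apply: (@loc_nonzero1 A p).
Qed.

Lemma open_immersion_res_eq0 (Y : ringed_space) (B : comNzRingType)
    (j : rs_hom (Spec B) Y) (U : opens Y) (s : sections Y U) (y : Y) :
  open_immersion j -> range j y -> oset U y -> hom_sec j U s = 0 ->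
  exists (V : opens Y) (VU : V `<=` U), oset V y /\ res VU s = 0.
Proof.
move=> jo jy Uy s0.
pose V : opens Y := Opens (openI (oset_open U) (oimm_open jo openT)).
have VU : V `<=` U by move=> x [].
have VU' : hom_preim j V `<=` hom_preim j U by move=> x; apply: VU.
have Vj : V `<=` range j by move=> x [].
exists V, VU; split; first by split.
apply: (bij_inj (oimm_sec jo Vj)); rewrite -(hom_res VU VU') s0.
by rewrite !rmorph0.
Qed.

Definition affine_over (K : fieldType) (A : comNzRingType) (iota : {rmorphism K -> A}) :
    scheme_over K :=
  @SchemeOver K (affine_scheme A) (Spec_map iota).

(** [Y] is known only by its universal property, so it is compared with [Spec R] through [u] instead
    of being identified with it. Every affine chart of [Y] factors through [u]; a section killed by
    [u] therefore vanishes on all charts, and the sections of [Y] embed into those of [Spec R]. *)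
Lemma geometric_domain_integral (K : fieldType) (A : comNzRingType)
    (iota : {rmorphism K -> A}) :
  geometric_domain iota -> geometrically_integral (affine_over iota).
Proof.
move=> gA K' f Y p q [pq univ].
have [R [alpha [beta [Rnz [ab push]]]]] := gA K' f.
have [|u [[up uq] uuniq]] := univ (affine_scheme R) (Spec_map alpha) (Spec_map beta).
  rewrite (Spec_map_comp (chi := alpha \o iota : {rmorphism _ -> _})) //.
  by symmetry; apply: Spec_map_comp => c; rewrite /= ab.
have factor (B : comNzRingType) (j : rs_hom (Spec B) Y) : exists v, j = rs_comp u v.
  have [phi phiE] := affine_hom (rs_comp p j).
  have [psi psiE] := affine_hom (rs_comp q j).
  have e c : phi (iota c) = psi (f c).
    have := Spec_map_comp (phi := iota) (psi := phi) (chi := phi \o iota : {rmorphism _ -> _})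
      (fun=> erefl).
    rewrite -phiE rs_compA pq -rs_compA psiE.
    rewrite (Spec_map_comp (chi := psi \o f : {rmorphism _ -> _})) // => /Spec_map_inj/(_ c) h.
    exact: esym h.
  have [theta [ta tb]] := push B phi psi e.
  exists (Spec_map theta).
  have [|w [_ wuniq]] := univ (affine_scheme B) (Spec_map phi) (Spec_map psi).
    rewrite (Spec_map_comp (chi := phi \o iota : {rmorphism _ -> _})) //.
    by symmetry; apply: Spec_map_comp => c; rewrite /= e.
  rewrite -(wuniq j); last by split.
  apply: wuniq; rewrite !rs_compA up uq; split; exact: Spec_map_comp.
split; first by exists (u (generic_pt Rnz)).
move=> U [y Uy]; have [B [j [jo [x _ xy]]]] := locally_affine y.
have jx : oset (hom_preim j U) x by rewrite /= xy.
split=> [/(congr1 (hom_sec j U))|s t st].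
  by rewrite rmorph1 rmorph0; apply: spec_section_neq0 jx.
have s0 (r : sections Y U) : hom_sec u U r = 0 -> r = 0.
  move=> r0; apply: section_eq0_local => z Uz.
  have [C [i [io iz]]] := locally_affine z; have [v iv] := factor C i.
  apply: open_immersion_res_eq0 io iz Uz _; rewrite iv /= r0.
  exact: rmorph0.
have := congr1 (hom_sec u U) st; rewrite rmorphM rmorph0.
by move=> /(spec_section_nz Rnz)[]/s0; [left|right].
Qed.

Lemma geometrically_integral_integral (K : fieldType) (X : scheme_over K) :
  geometrically_integral X -> integral_scheme X.
Proof.
move=> gX; apply: (gX K idfun X (rs_id X) (structure_map X)); split.
  by rewrite rs_comp_idr Spec_map_id rs_comp_idl.
move=> T a b; rewrite Spec_map_id rs_comp_idl => ab.
exists a; split; first by rewrite rs_comp_idl.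
by move=> v [<- _]; rewrite rs_comp_idl.
Qed.

(** * Points over large fields and Weil restriction *)

Lemma monic_annihilator (K : fieldType) (L : fieldExtType K) (al : L) :
  exists2 p : {poly K}, p \is monic & (map_poly (in_alg L) p).[al] = 0.
Proof.
have /polyOver1P[q qE] := minPolyOver 1%AS al.
exists q; last by rewrite -qE minPolyxx.
by rewrite -(map_monic (in_alg L)) -qE monic_minPoly.
Qed.

Lemma idomain_nz (R : idomainType) : no_zero_divisors R.
Proof. by move=> x y /eqP; rewrite mulf_eq0 => /orP[]/eqP; [left|right]. Qed.

Definition field_pt (F : fieldType) : Spec F := generic_pt (@idomain_nz F).

Lemma spec_field_pt (F : fieldType) (q : Spec F) : q = field_pt F.
Proof.
apply: spec_pt_ext => a; rewrite generic_ptE.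
have [->|a0] := eqVneq a 0; first exact: rpred0.
apply: contraFF (idealr1 (q : spec_pt F)) => aq.
by rewrite -(mulVf a0) idealMr.
Qed.

Section LargeField.
Variable K : fieldType.
Hypothesis Klarge : large_field K.

Lemma large_newton N (B : 'I_N -> {mpoly K[N.+1]}) (C : 'I_N -> 'I_N -> {mpoly K[N.+1]}) :
  (forall i j, meval (fun=> 0) (C i j) = 0) -> forall T : seq K,
  exists2 v : 'I_N.+1 -> K, v ord_max \notin T & forall i, meval v (newton_eq B C i) = 0.
Proof.
move=> C0 T; have [Q [iota [x [eps [Qs Qnz Qg [xH xt epsK]]]]]] := newton_algebra B C0.
pose X := affine_over iota.
have idE : rs_comp (structure_map X) (rs_id (Spec Q)) = Spec_map iota by apply: rs_comp_idr.
have idI : open_immersion (rs_id X).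
  by split=> [//|V|U _]; [rewrite image_id|exists idfun].
pose U : chart X := Chart idI idE.
have fX : finite_type X.
  exists 1%N, (fun=> U); split=> [_|y]; last by exists ord0, y.
  by have [n [c [cn [y [f [gen _ _]]]]]] := Qs; exists n, y.
have rX : has_smooth_rational_point X.
  exists (Spec_map eps (field_pt K)).
    by exists (Spec_map eps); [apply: Spec_map_comp|exists (field_pt K)].
  by exists U; split=> //; eexists.
(* [P] is nonzero in the domain [Q], so its nonvanishing locus is a nonempty open set, which by
   density has a rational point. *)
pose P := \prod_(c <- T) (x ord_max - iota c).
have P0 : P <> 0.
  rewrite /P; elim: (T) => [|c S IH]; first by rewrite big_nil; apply/eqP/oner_neq0.
  by rewrite big_cons => /Qnz[/eqP|//]; rewrite subr_eq0 => /eqP /xt.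
have oD : open (primes_outside [set P]) by exists [set P].
have [|y [[g gP gy] [h hK [q _ hq]]]] := Klarge (geometric_domain_integral Qg) fX rX _ oD.
  by exists (generic_pt Qnz), P => //; rewrite generic_ptE; apply/eqP.
have [chi chiE] := affine_hom h; subst h.
have chiK c : chi (iota c) = c.
  move: hK; rewrite /points /= (Spec_map_comp (chi := chi \o iota : {rmorphism _ -> _})) //.
  by move=> /Spec_map_inj/(_ c).
exists (chi \o x) => [|i].
  apply/negP => xT; case/negP: gy; rewrite (gP : g = P) -hq.
  rewrite (pulls_back_mem _ _ (Spec_map_pulls chi)) (rmorph_prod chi).
  rewrite (big_rem _ xT) /= rmorphB chiK subrr mul0r; exact: rpred0.
rewrite -[RHS](rmorph0 chi) -(xH i); symmetry.
by apply: (rmorph_mmap (g := chi)).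
Qed.

Variables (L : fieldExtType K) (al : L).
Variables (n c : nat) (cn : (c < n)%N) (f : 'I_c -> {mpoly K[n]}) (a : 'I_n -> K).
Hypothesis fa : forall i, meval a (f i) = 0.
Hypothesis Ja : \det (\matrix_(i < c, j < c)
  meval a (mderiv (widen_ord (ltnW cn) j) (f i))) != 0.

(** The [G l] are coordinates of [F] modulo [p]. Evaluated at the origin, the remainder stays of
    smaller degree than [p]; if [F] vanishes there, the remainder is also a multiple of [p], hence
    zero. *)
Lemma monic_reduction m (p : {poly K}) (F : {poly {mpoly K[m]}}) :
  p \is monic -> exists (G : nat -> {mpoly K[m]}) (q : {poly {mpoly K[m]}}),
    F = \sum_(l < (size p).-1) G l *: 'X^l + q * map_poly (@mpolyC m K) p /\
    (map_poly (meval (fun=> 0)) F = 0 -> forall l, meval (fun=> 0) (G l) = 0).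
Proof.
move=> pm; set p' := map_poly _ p.
have pm' : p' \is monic by apply: monic_map.
have sp : size p' = size p.
  by apply: size_map_poly_id0; rewrite (monicP pm) mpolyC1 oner_neq0.
pose r := Pdiv.CommonRing.rmodp F p'; pose q := Pdiv.CommonRing.rdivp F p'.
have Fqr : F = q * p' + r by apply: Pdiv.RingMonic.rdivp_eq.
have sr : (size r <= (size p).-1)%N.
  have := Pdiv.Ring.ltn_rmodpN0 F (monic_neq0 pm'); rewrite -/r sp.
  by case: (size p).
exists (fun l => r`_l), q; split=> [|F0 l].
  rewrite {1}Fqr addrC; congr (_ + _); rewrite -poly_def.
  by apply/polyP => l; rewrite coef_poly; case: ltnP => // h; rewrite nth_default // (leq_trans sr).
have evp : map_poly (meval (fun=> 0)) p' = p.
  by apply/polyP => k; rewrite !coef_map /= mevalC.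
move: F0; rewrite {1}Fqr rmorphD rmorphM /= evp => /eqP; rewrite addrC addr_eq0 => /eqP h.
have : map_poly (meval (fun=> 0)) r = 0.
  apply/eqP/contraT => r0; have := dvdp_mulIr (map_poly (meval (fun=> 0)) q) p.
  rewrite -dvdpNr -h => /(dvdp_leq r0); rewrite leqNgt => /negP[].
  rewrite (leq_ltn_trans (size_poly _ _)) // (leq_ltn_trans sr) //.
  by have := monic_neq0 pm; rewrite -size_poly_eq0; case: (size p).
by move/polyP/(_ l); rewrite coef_map coef0.
Qed.

(** The system is multiplied by the inverse of its Jacobian at [a]. This makes the linear part the
    identity, as [newton_eq] demands, and keeps the zeros since the factor is invertible. *)
Lemma normalized_expansion : exists (g : 'I_c -> {mpoly K[n]}) (D : 'I_c -> 'I_n -> {mpoly K[n]}),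
  [/\ forall i, g i = \sum_s (MX s - MC (a s)) * D i s,
      forall i j, meval a (D i (widen_ord (ltnW cn) j)) = (i == j)%:R &
      forall (v : 'I_n -> L), (forall i, mmap (in_alg L) v (g i) = 0) ->
        forall i, mmap (in_alg L) v (f i) = 0].
Proof.
pose J := \matrix_(i < c, j < c) meval a (mderiv (widen_ord (ltnW cn) j) (f i)).
have Ju : J \in unitmx by rewrite unitmxE unitfE.
have /choice[D0 D0E] i := hadamard_root (fa i).
pose g i := \sum_l MC (invmx J i l) * f l.
pose D i s := \sum_l MC (invmx J i l) * D0 l s.
exists g, D; split=> [i|i j|v gv i].
- rewrite /g /D; under [RHS]eq_bigr => s _ do rewrite mulr_sumr.
  rewrite exchange_big /=; apply: eq_bigr => l _.
  by have [-> _] := D0E l; rewrite mulr_sumr; apply: eq_bigr => s _; rewrite mulrCA.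
- rewrite /D (raddf_sum (meval a)) /=; have /matrixP/(_ i j) := mulVmx Ju; rewrite !mxE => <-.
  apply: eq_bigr => l _; rewrite mevalM mevalC; have [_ ->] := D0E l.
  by rewrite mxE.
- have -> : f i = \sum_l MC (J i l) * g l.
    rewrite /g; under eq_bigr => l _ do rewrite mulr_sumr.
    rewrite exchange_big /= (bigD1 i) //= [X in _ + X]big1 => [|k ki].
      rewrite addr0; under eq_bigr => l _ do rewrite mulrA -mpolyCM.
      rewrite -mulr_suml -raddf_sum /=.
      have /matrixP/(_ i i) := mulmxV Ju; rewrite !mxE eqxx => ->.
      by rewrite mpolyC1 mul1r.
    under eq_bigr => l _ do rewrite mulrA -mpolyCM.
    rewrite -mulr_suml -raddf_sum /=.
    have /matrixP/(_ i k) := mulmxV Ju; rewrite !mxE eq_sym (negbTE ki) => ->.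
    by rewrite mulr0n (_ : MC 0 = 0) ?mul0r //; exact: mpolyC0.
  rewrite (rmorph_sum (mmap (in_alg L) v)) big1 // => l _.
  by rewrite (rmorphM (mmap (in_alg L) v)) /= gv mulr0.
Qed.
(* Weil restriction: the coordinates [y_(j, k)] of the unknowns in the powers of [al]
   are made variables over [K], and the [c]-th coordinate is [a_c + t al]. *)
Lemma large_restriction (T : seq K) : exists2 t, t \notin T &
  exists2 v : 'I_n -> L, forall i, mmap (in_alg L) v (f i) = 0 &
    v (Ordinal cn) = (a (Ordinal cn))%:A + t *: al.
Proof.
have [p pm pal] := monic_annihilator al.
have [g [D [gE Da gf]]] := normalized_expansion.
pose m := (size p).-1; pose I : finType := ('I_c * 'I_m)%type; pose N := #|{: I}|.
pose s0 := Ordinal cn; pose wd := widen_ord (ltnW cn).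
pose Y (x : I) : {mpoly K[N.+1]} := MX (lift ord_max (enum_rank x)).
pose t : {mpoly K[N.+1]} := MX ord_max.
(* Displacement of the coordinate [s] from [a s], with ['X] standing for [al]: generic before [c],
   [t * 'X] at [c], zero afterwards. *)
pose U (s : 'I_n) : {poly {mpoly K[N.+1]}} :=
  if insub (s : nat) is Some j then \sum_(k < m) Y (j, k) *: 'X^k
  else if s == s0 then t *: 'X else 0.
have Uw j : U (wd j) = \sum_(k < m) Y (j, k) *: 'X^k.
  rewrite /U; case: insubP => [j' _ jj'|]; last by rewrite /= ltn_ord.
  by have -> : j' = j by apply: val_inj.
have Uc : U s0 = t *: 'X by rewrite /U insubN ?ltnn // eqxx.
have Uo (s : 'I_n) : ~~ (s < c)%N -> s != s0 -> U s = 0.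
  by move=> sc /negbTE ss; rewrite /U insubN // ss.
pose pt (s : 'I_n) := (MC (a s))%:P + U s.
pose Phi : {rmorphism {mpoly K[n]} -> {poly {mpoly K[N.+1]}}} :=
  mmap (polyC \o @mpolyC N.+1 K) pt.
have PhiC k : Phi (MC k) = (MC k)%:P by exact: mmapC.
have Phipt s : Phi (MX s) = pt s by exact: mmapXU.
have PhiX s : Phi (MX s - MC (a s)) = U s.
  by rewrite rmorphB PhiC Phipt /pt addrC addKr.
clearbody Phi.
pose ev0 : {rmorphism {poly {mpoly K[N.+1]}} -> {poly K}} := map_poly (meval (fun=> 0)).
have U0 (s : 'I_n) : ev0 (U s) = 0.
  rewrite /U; case: insubP => [j _ _|_].
    rewrite rmorph_sum big1 // => k _; rewrite /= map_polyZ /= mevalXv scale0r //.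
  case: eqP => _; last exact: rmorph0.
  by rewrite /= map_polyZ /= mevalXv scale0r.
have ev0Phi P : ev0 (Phi P) = (meval a P)%:P.
  elim/mpoly_ring_ind: P => [k|s|P Q eP eQ|P Q eP eQ].
  - by rewrite PhiC /= map_polyC /= !mevalC.
  - by rewrite Phipt /pt rmorphD U0 addr0 /= map_polyC /= mevalC mevalXv.
  - by rewrite !rmorphD eP eQ.
  - by rewrite !rmorphM eP eQ.
have red F : exists G : nat -> {mpoly K[N.+1]}, (exists q,
    F = \sum_(l < m) G l *: 'X^l + q * map_poly (@mpolyC N.+1 K) p) /\
    (ev0 F = 0 -> forall l, meval (fun=> 0) (G l) = 0).
  by have [G [q [FG G0]]] := monic_reduction F pm; exists G; split=> //; exists q.
clearbody ev0.
(* Subtracting the Kronecker symbol separates the identity linear part; what remains vanishes at the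
   origin and provides [C]. The terms carrying the factor [t] provide [B]. *)
have /choice[G1 G1P] (x : 'I_c * I) :=
  red ('X^(x.2.2) * (Phi (D x.1 (wd x.2.1)) - (x.1 == x.2.1)%:R)).
have /choice[G2 G2P] (i : 'I_c) := red ('X * Phi (D i s0)).
pose B (r : 'I_N) := G2 (enum_val r).1 (enum_val r).2.
pose C (r r' : 'I_N) := G1 ((enum_val r).1, enum_val r') (enum_val r).2.
have C0 r r' : meval (fun=> 0) (C r r') = 0.
  have [_ ->] := G1P ((enum_val r).1, enum_val r') => //=.
  by rewrite rmorphM rmorphB ev0Phi Da !rmorph_nat subrr mulr0.
have [v0 v0T v0E] := large_newton B C0 T.
exists (v0 ord_max) => //.
pose Ev : {rmorphism {poly {mpoly K[N.+1]}} -> L} :=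
  horner_eval al \o map_poly (in_alg L \o meval v0 : {rmorphism _ -> _}).
have EvC P : Ev P%:P = (meval v0 P)%:A by rewrite /= /horner_eval map_polyC hornerC.
have EvX : Ev 'X = al by rewrite /= /horner_eval map_polyX hornerX.
have EvZ P F : Ev (P *: F) = meval v0 P *: Ev F.
  by rewrite -mul_polyC rmorphM EvC mulr_algl.
have Evp : Ev (map_poly (@mpolyC N.+1 K) p) = 0.
  rewrite -[RHS]pal /= /horner_eval; congr horner; apply/polyP => k.
  by rewrite !coef_map /= mevalC.
clearbody Ev.
have EvG F (G : nat -> {mpoly K[N.+1]}) : (exists q,
    F = \sum_(l < m) G l *: 'X^l + q * map_poly (@mpolyC N.+1 K) p) ->
    Ev F = \sum_(l < m) meval v0 (G l) *: al ^+ l.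
  move=> [q ->]; rewrite rmorphD rmorphM Evp mulr0 addr0 rmorph_sum.
  by apply: eq_bigr => l _; rewrite EvZ rmorphXn EvX.
exists (Ev \o pt) => [|/=]; last first.
  by rewrite -[LHS]/(Ev (pt s0)) /pt Uc rmorphD EvC EvZ EvX mevalC [meval v0 t]mevalXv.
apply: gf => i.
have -> : mmap (in_alg L) (Ev \o pt) (g i) = Ev (Phi (g i)).
  apply: (@rmorph_mpoly_ext _ _ _ (mmap (in_alg L) (Ev \o pt)) (Ev \o Phi : {rmorphism _ -> _})).
    move=> k; apply: etrans (mmapC _ _ _) _; symmetry.
    by apply: etrans (congr1 Ev (PhiC k)) _; rewrite EvC mevalC.
  by move=> s; apply: etrans (mmapXU _ _ _) (esym (congr1 Ev (Phipt s))).
have -> : Phi (g i) = \sum_s U s * Phi (D i s).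
  by rewrite gE rmorph_sum; apply: eq_bigr => s _; rewrite rmorphM PhiX.
have -> : \sum_s U s * Phi (D i s) =
    \sum_(j < c) U (wd j) * Phi (D i (wd j)) + U s0 * Phi (D i s0).
  rewrite (bigID (fun s : 'I_n => (s < c)%N)) /=; congr (_ + _).
    by rewrite (big_ord_narrow (ltnW cn)).
  rewrite (bigD1 s0) ?ltnn //= big1 ?addr0 // => s /andP[sc ss].
  by rewrite Uo // mul0r.
rewrite rmorphD rmorph_sum /=.
have -> : Ev (U s0 * Phi (D i s0)) = \sum_(l < m) meval v0 (t * G2 i l) *: al ^+ l.
  rewrite Uc -scalerAl EvZ (EvG _ _ (proj1 (G2P i))) scaler_sumr.
  by apply: eq_bigr => l _; rewrite scalerA -mevalM.
have EvU j : Ev (U (wd j) * Phi (D i (wd j))) = \sum_(k < m) meval v0 (Y (j, k)) *: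
    ((i == j)%:R * al ^+ k + \sum_(l < m) meval v0 (G1 (i, (j, k)) l) *: al ^+ l).
  rewrite Uw mulr_suml rmorph_sum; apply: eq_bigr => k _.
  rewrite -scalerAl EvZ; congr (_ *: _).
  rewrite -(EvG _ _ (proj1 (G1P (i, (j, k))))) /=.
  have -> : (i == j)%:R * al ^+ k = Ev ((i == j)%:R * 'X^k).
    by rewrite rmorphM rmorph_nat rmorphXn EvX.
  by rewrite -rmorphD; congr (Ev _); ring.
rewrite (eq_bigr _ (fun j _ => EvU j)).
under eq_bigr => j _ do under eq_bigr => k _ do rewrite scalerDr.
under eq_bigr => j _ do rewrite big_split /=.
rewrite big_split /= (bigD1 i) //= [X in _ + X + _ + _]big1 => [|j]; last first.
  by rewrite eq_sym => /negbTE ->; rewrite big1 // => k _; rewrite mul0r scaler0.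
rewrite addr0 eqxx; under eq_bigr => k _ do rewrite mul1r.
rewrite pair_bigA /=; under [X in _ + X + _]eq_bigr => x _ do rewrite scaler_sumr.
rewrite exchange_big /= -!big_split /= big1 // => l _.
(* The coefficient of [al ^+ l] in the value of [g i] is the Newton equation of index [(i, l)] at
   [v0]. *)
have := v0E (enum_rank (i, l)); rewrite /newton_eq !mevalD /B /C enum_rankK /=.
rewrite (reindex (@enum_rank I)) /=; last exact/onW_bij/enum_rank_bij.
rewrite (raddf_sum (meval v0)) /= => e.
under [X in _ + X + _]eq_bigr => x _ do rewrite scalerA.
rewrite -scaler_suml -!scalerDl; apply: etrans (scale0r (al ^+ l)); congr (_ *: _).
apply: etrans e; rewrite addrAC; congr (_ + _).
by apply: eq_bigr => -[j k] _; rewrite enum_rankK mevalM.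
Qed.

End LargeField.

(** * New points *)

Section Readings.
Variables (X : ringed_space) (A : comNzRingType) (j : rs_hom (Spec A) X).
Hypothesis jo : open_immersion j.

Definition chart_open : opens X := Opens (oimm_open jo openT).

Lemma chart_open_range : chart_open `<=` range j. Proof. by []. Qed.

Lemma chart_openE q : oset chart_open (j q). Proof. by exists q. Qed.

(* The function [a] of the chart takes the value [b] at the [B]-point [h]. *)
Definition reads (B : comNzRingType) (h : rs_hom (Spec B) X) (a : A) (b : B) :=
  forall s : sections X chart_open,
    hom_sec j chart_open s = spec_cst _ a -> hom_sec h chart_open s = spec_cst _ b.

Lemma chart_section a : exists s : sections X chart_open, hom_sec j chart_open s = spec_cst _ a.
Proof.
have [g _ gK] := oimm_sec jo chart_open_range.
by exists (g (spec_cst _ a)); rewrite gK.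
Qed.

(** A point landing in the chart is reduced to its coordinates here, which spares the factorization
    of [h] through [j] as a morphism. *)
Lemma ex_reads (B : comNzRingType) (h : rs_hom (Spec B) X) :
  (forall q, range j (h q)) ->
  exists theta : {rmorphism A -> B}, forall a, reads h a (theta a).
Proof.
move=> hj.
have [g [gK _]] := bij_rmorph_inv (oimm_sec jo chart_open_range).
have [k [_ kK]] := bij_rmorph_inv (@spec_cst_bij B (hom_preim h chart_open) hj).
exists (k \o (hom_sec h chart_open \o (g \o spec_cst _)) : {rmorphism _ -> _}) => a s js /=.
by rewrite -js gK kK.
Qed.

Lemma reads_inj (B : comNzRingType) (h : rs_hom (Spec B) X) a b b' :
  (forall q, range j (h q)) -> reads h a b -> reads h a b' -> b = b'.
Proof.
move=> hj hb hb'; have [s js] := chart_section a.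
by apply: (@spec_cst_inj B (hom_preim h chart_open)) => //; rewrite -(hb s js) -(hb' s js).
Qed.

Lemma reads_comp (B C : comNzRingType) (g : rs_hom (Spec B) X) (v : {rmorphism B -> C}) a b :
  reads g a b -> reads (rs_comp g (Spec_map v)) a (v b).
Proof.
move=> gb s /gb gs.
apply: etrans (@Spec_map_pulls _ _ v (hom_preim g chart_open) b).
exact: (congr1 (hom_sec (Spec_map v) (hom_preim g chart_open)) gs).
Qed.

Lemma reads_chart a : reads j a a. Proof. by move=> s ->. Qed.

Section OverField.
Variables (K : fieldType) (str : rs_hom X (Spec K)) (c : K).

Definition const_section (V : opens X) : sections X V :=
  res (fun x _ => I : oset (hom_preim str (Opens openT)) x)
      (hom_sec str (Opens openT) (spec_cst (Opens openT) c)).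

Lemma hom_const_section (B : comNzRingType) (h : rs_hom (Spec B) X) beta V :
  rs_comp str h = Spec_map beta -> hom_sec h V (const_section V) = spec_cst _ (beta c).
Proof.
move=> hb; have pb : pulls_back (rs_comp str h) beta by rewrite hb; apply: Spec_map_pulls.
have VT : hom_preim h V `<=` hom_preim h (hom_preim str (Opens openT)) by [].
rewrite /const_section -(hom_res (r := h) _ VT).
have := pb (Opens openT) c; rewrite /= => e.
apply: etrans (congr1 (res VT) e) _; exact: res_cst.
Qed.

Lemma reads_scalar (B : comNzRingType) (h : rs_hom (Spec B) X) alpha beta :
  rs_comp str j = Spec_map alpha -> rs_comp str h = Spec_map beta ->
  reads h (alpha c) (beta c).
Proof.
move=> ja hb s js; suff -> : s = const_section chart_open by apply: hom_const_section.
apply: (bij_inj (oimm_sec jo chart_open_range)).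
by rewrite js (hom_const_section _ ja).
Qed.

End OverField.

End Readings.

(** * Irreducibility and the zero-dimensional case *)

Lemma sections_empty (X : ringed_space) (U : opens X) (s t : sections X U) :
  (forall x, ~ oset U x) -> s = t.
Proof.
move=> U0; apply/eqP; rewrite -subr_eq0; apply/eqP.
by apply: section_eq0_local => x /U0.
Qed.

(** If [U] and [V] were disjoint, the sections of their union equal to [1] on one part and [0] on
    the other would be zero divisors. *)
Lemma integral_inter (X : scheme) (U V : opens X) :
  integral_scheme X -> U !=set0 -> V !=set0 -> (U `&` V) !=set0.
Proof.
move=> [_ iX] [x Ux] [y Vy]; apply: contrapT => UV0.
have {}UV0 z : oset U z -> oset V z -> False by move=> Uz Vz; apply: UV0; exists z.
pose W : opens X := Opens (openU (oset_open U) (oset_open V)).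
pose F (b : bool) := if b then U else V.
have FW b : F b `<=` W by case: b => z; [left|right].
have cov : W `<=` \bigcup_b F b by move=> z [Uz|Vz]; [exists true|exists false].
have glue (e : bool) : exists t : sections X W, forall b, res (FW b) t = (b == e)%:R.
  apply: (sheaf_glue FW cov (s := fun b => (b == e)%:R)) => b b' O Ob Ob'.
  have [bb|nbb] := eqVneq b b'; first by subst b'; rewrite (Prop_irrelevance Ob Ob').
  apply: sections_empty => z Oz; move: nbb (Ob z Oz) (Ob' z Oz).
  by case: (b); case: (b') => //= _ h1 h2; [apply: UV0 h1 h2|apply: UV0 h2 h1].
have [s sE] := glue true; have [t tE] := glue false.
have [|_ /(_ s t)[]] := iX W; first by exists x; left.
- apply: (sheaf_separated (V := F) (VU := FW)) => // b.
  by rewrite rmorphM sE tE rmorph0; case: b; rewrite ?mulr0 ?mul0r.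
- move=> s0; have [|+ _] := iX (F true); first by exists x.
  by apply; rewrite -[1](sE true) s0 rmorph0.
- move=> t0; have [|+ _] := iX (F false); first by exists y.
  by apply; rewrite -[1](tE false) t0 rmorph0.
Qed.

Lemma chart_nz (X : scheme) (B : comNzRingType) (j : rs_hom (Spec B) X) (q : Spec B) :
  integral_scheme X -> open_immersion j -> no_zero_divisors B.
Proof.
move=> [_ iX] jo b b' bb'.
have [|_ nz] := iX (chart_open jo); first by exists (j q); apply: chart_openE.
have [s js] := chart_section jo b; have [t jt] := chart_section jo b'.
have inj := bij_inj (oimm_sec jo (@chart_open_range _ _ _ jo)).
have full p : oset (hom_preim j (chart_open jo)) p by apply: chart_openE.
have r0 r c : hom_sec j (chart_open jo) r = spec_cst _ c -> r = 0 -> c = 0.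
  by move=> rc r0; apply: (spec_cst_inj full); rewrite -rc r0 !rmorph0.
have [|/(r0 _ _ js)|/(r0 _ _ jt)] := nz s t; [|by left|by right].
by apply: inj; rewrite rmorphM js jt -rmorphM bb' !rmorph0.
Qed.

Lemma spec_units_pt (A : comNzRingType) (p q : Spec A) :
  (forall a : A, a = 0 \/ exists b, a * b = 1) -> p = q.
Proof.
move=> Au; suff E (r : Spec A) a : (a \in (r : spec_pt A)) = (a == 0).
  by apply: spec_pt_ext => a; rewrite !E.
have [->|a0] := eqVneq a 0; first exact: rpred0.
have [/eqP|[b ab]] := Au a; first by rewrite (negbTE a0).
apply: contraFF (idealr1 (r : spec_pt A)) => ar.
by rewrite -ab mulrC idealMr.
Qed.

(** Any other chart meets the one-point chart [U]. A function on it agrees with a constant near the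
    common point, hence everywhere because its ring is a domain; so this ring is a field and its
    spectrum is that point alone. *)
Lemma integral_one_point (K : fieldType) (X : scheme_over K) (U : chart X)
    (q : Spec (chart_ring U)) :
  integral_scheme X -> (forall a, exists c, chart_alg U c = a) -> forall z : X, z = U q.
Proof.
move=> iX alpha_surj z; have jo := chart_immersion U; set j := chart_map U in jo *.
have [B [i [io [b0 _ iz]]]] := locally_affine z.
have Aone p : p = q.
  apply: spec_units_pt => a; have [c <-] := alpha_surj a.
  have [->|c0] := eqVneq c 0; [by left; rewrite rmorph0|right].
  by exists (chart_alg U c^-1); rewrite -rmorphM mulfV // rmorph1.
have [x [[p _ px] [b1 _ ib1]]] : (chart_open jo `&` chart_open io) !=set0.
  by apply: integral_inter => //; [exists (j q)|exists (i b0)]; apply: chart_openE.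
rewrite (Aone p) in px; rewrite -iz px -ib1; congr (i _).
have Bnz := chart_nz b0 iX io.
pose V := chart_open io.
pose O : opens X := Opens (openI (oset_open V) (oset_open (chart_open jo))).
have OV : O `<=` V by move=> y [].
have OV' : hom_preim i O `<=` hom_preim i V by move=> y; apply: OV.
have Oj : O `<=` range j by move=> y [].
have full p' : oset (hom_preim i V) p' by apply: chart_openE.
have Ofull p' : oset (hom_preim j O) p'.
  by rewrite (Aone p') /= px; split; [exists b1|exists q].
have Ob1 : oset (hom_preim i O) b1 by rewrite /= ib1 -px; apply: Ofull.
pose str := structure_map X.
have const_eq b : exists c : K, spec_cst (hom_preim i V) b = hom_sec i V (const_section str c V).
  have [s is_b] := chart_section io b.
  have [k _ kK] := @spec_cst_bij _ (hom_preim j O) Ofull.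
  have [c ck] := alpha_surj (k (hom_sec j O (res OV s))).
  exists c; rewrite -is_b; set tau := const_section str c V.
  have tauO : res OV s = res OV tau.
    apply: (bij_inj (oimm_sec jo Oj)).
    have -> : res OV tau = const_section str c O.
      exact: res_res.
    by rewrite (hom_const_section _ _ (chart_over U)) ck kK.
  have [k' _ k'K] := @spec_cst_bij _ (hom_preim i V) full.
  pose d := k' (hom_sec i V s - hom_sec i V tau).
  have dE : spec_cst (hom_preim i V) d = hom_sec i V s - hom_sec i V tau by rewrite k'K.
  suff d0 : d = 0.
    by apply/eqP; rewrite -subr_eq0 -dE d0 rmorph0.
  (* [d] vanishes on the basic open set of [g], so a power of the nonzero [g] kills it. *)
  have [g gb1 gO] := open_basic Ob1.
  have [r gr|N] := @frac_zero B d g.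
    have Or := gO r gr.
    have : spec_cst (hom_preim i O) d = 0.
      by rewrite -(res_cst OV') dE rmorphB !(hom_res OV OV') tauO subrr.
    by move/(congr1 (fun t : spec_section (hom_preim i O) => t (exist _ r Or))).
  have g0 : g <> 0 by move=> g0; move: gb1; rewrite g0 rpred0.
  by elim: N => [|N IH]; rewrite ?expr0 ?mul1r // exprS -mulrA => /Bnz[].
apply: spec_units_pt => b; have [c bc] := const_eq b.
have [k _ kK] := @spec_cst_bij _ (hom_preim i V) full.
have inj := spec_cst_inj full.
have [c0|c0] := eqVneq c 0; [left|right].
  by apply: inj; rewrite bc c0 /const_section !rmorph0.
exists (k (hom_sec i V (const_section str c^-1 V))); apply: inj.
rewrite (rmorphM (spec_cst _)) kK bc.
have cc : const_section str c V * const_section str c^-1 V = 1.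
  by rewrite /const_section -!rmorphM mulfV // !rmorph1.
have := congr1 (hom_sec i V) cc; rewrite rmorphM /= => ->.
by rewrite !rmorph1.
Qed.

Lemma dim_ge1_points (T : topologicalType) (x : T) : dim_ge T 1 -> ~ forall z, z = x.
Proof.
move=> [Z [Zirr Zlt]] Tx; have [_ [y Zy] _] := Zirr ord0.
have [_] := Zlt ord0 ord_max isT; apply=> z _.
by rewrite (Tx z) -(Tx y).
Qed.

(** Expanding the equations at the rational point gives a linear system for the [x s - iota (a s)].
    Its determinant is nonzero in [A], because [theta] maps it to the Jacobian, and Cramer's rule
    makes each coordinate constant. *)
Lemma etale_domain_trivial (K : fieldType) (A : comNzRingType) (iota : {rmorphism K -> A})
    (theta : {rmorphism A -> K}) n (x : 'I_n -> A) (f : 'I_n -> {mpoly K[n]}) :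
  no_zero_divisors A -> (forall c, theta (iota c) = c) ->
  (forall y, exists P, mmap iota x P = y) -> (forall i, mmap iota x (f i) = 0) ->
  \det (\matrix_(i, s) meval (theta \o x) (mderiv s (f i))) <> 0 ->
  forall y, exists c, iota c = y.
Proof.
move=> Anz thetaK gen fx J0; pose a := theta \o x.
have thetaE P : theta (mmap iota x P) = meval a P.
  exact: (@rmorph_mmap _ _ _ _ _ theta x a idfun P thetaK (fun=> erefl)).
have /choice[D DE] i : exists D : 'I_n -> {mpoly K[n]},
    f i = \sum_s (MX s - MC (a s)) * D s /\ forall s, meval a (D s) = meval a (mderiv s (f i)).
  by apply: hadamard_root; rewrite -thetaE fx rmorph0.
pose d := \matrix_(i, s) mmap iota x (D i s).
have dx i : \sum_s d i s * (x s - iota (a s)) = 0.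
  rewrite -[RHS](fx i); have [-> _] := DE i; rewrite rmorph_sum; apply: eq_bigr => s _.
  by rewrite mxE rmorphM rmorphB /= mmapXU mmapC mulrC.
have xa s : x s = iota (a s).
  apply/eqP; rewrite -subr_eq0; apply/eqP.
  have := cramer dx s; rewrite big1 => [/Anz[d0|//]|k _]; last by rewrite mulr0.
  case: J0; rewrite -[RHS](rmorph0 theta) -d0 -det_map_mx; congr (\det _).
  by apply/matrixP => i k; rewrite !mxE thetaE; have [_ ->] := DE i.
move=> y; have [P <-] := gen y; exists (meval a P); symmetry.
elim/mpoly_ring_ind: P => [c|s|P Q eP eQ|P Q eP eQ].
- by rewrite mmapC mevalC.
- by rewrite mmapXU mevalXv.
- by rewrite mevalD !rmorphD /= eP eQ.
- by rewrite mevalM !rmorphM /= eP eQ.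
Qed.

(** A nonzero [al] is wanted so that [t] can be recovered from [t *: al]. If the primitive element
    is [0], then it lies in every subfield and [1] serves. *)
Lemma ex_generator (K : fieldType) (L : fieldExtType K) : separable 1 {:L} ->
  exists2 al : L, al != 0 & forall F : {subfield L}, al \in F -> F = {:L}%AS.
Proof.
move=> sL; set be := separable_generator 1 {:L}.
have Lbe : ({:L} = <<1; be>>)%VS by apply: eq_adjoin_separable_generator => //; apply: subvf.
have full (F : {subfield L}) : be \in F -> F = {:L}%AS.
  move=> bF; apply/val_inj/eqP; rewrite /= eqEsubv subvf Lbe.
  by apply/FadjoinP; rewrite sub1v.
have [be0|be0] := eqVneq be 0; last by exists be.
by exists 1 => [|F _]; [exact: oner_neq0|apply: full; rewrite be0 rpred0].
Qed.

Theorem proposition8p3 (K : fieldType) (X : scheme_over K) (L : fieldExtType K) :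
  large_field K ->
  geometrically_integral X ->
  finite_type X ->
  dim_ge X 1 ->
  has_smooth_rational_point X ->
  separable 1 {:L} ->
  infinite_set (new_points X L).
Proof.
move=> Klarge gX _ dimX [x0 [h hK [p0 _ hp0]]].
move=> [U [[q0 _ Uq0] [n [c [cn [y [f [gen ker [b Jb]]]]]]]]].
move=> /ex_generator[al al0 alF].
have iX := geometrically_integral_integral gX; have Uo := chart_immersion U.
set A := chart_ring U in y gen b ker Jb q0 Uq0 *.
set iota := chart_alg U in gen ker Jb.
have hU q : range U (h q) by exists q0 => //; rewrite Uq0 (spec_field_pt q) -(spec_field_pt p0).
have [theta thetaE] := ex_reads Uo hU.
have thetaK k : theta (iota k) = k.
  by apply: (reads_inj hU (thetaE _)); apply: (reads_scalar (chart_over U) hK).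
pose a := theta \o y.
have evE P : theta (mmap iota y P) = meval a P.
  exact: (@rmorph_mmap _ _ _ _ _ theta y a idfun P thetaK (fun=> erefl)).
have fy i : mmap iota y (f i) = 0 by apply/ker; exact: gen_ideal_gen.
have fa i : meval a (f i) = 0 by rewrite -evE fy rmorph0.
have Ja : \det (\matrix_(i < c, j < c) meval a (mderiv (widen_ord cn j) (f i))) != 0.
  apply: contra_eq_neq (congr1 theta Jb) => J0.
  rewrite rmorphM -det_map_mx rmorph1 (_ : \det _ = 0) ?mulr0 1?eq_sym ?oner_neq0 //.
  by rewrite -J0; congr (\det _); apply/matrixP => i j; rewrite !mxE evE.
(* With as many equations as coordinates the chart ring is [K], and [X] would be one point. *)
have cltn : (c < n)%N.
  rewrite ltn_neqAle cn andbT; apply/eqP => cn'; subst c.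
  have wid (j : 'I_n) : widen_ord cn j = j by apply: val_inj.
  apply: (dim_ge1_points (x := U q0) dimX); apply: (integral_one_point q0 iX).
  apply: (etale_domain_trivial (chart_nz q0 iX Uo) thetaK gen fy); apply/eqP.
  have -> : \matrix_(i, s) meval (theta \o y) (mderiv s (f i)) =
    \matrix_(i < n, j < n) meval a (mderiv (widen_ord cn j) (f i)); last exact: Ja.
  by apply/matrixP => i j; rewrite !mxE wid.
rewrite (bool_irrelevance cn (ltnW cltn)) in Ja.
pose j0 := Ordinal cltn.
pose R (g : rs_hom (Spec L) X) t := reads Uo g (y j0) ((a j0)%:A + t *: al).
(* The parameter of an [L]-point; the default [0] is taken when no [t] fits, for instance when the
   coordinate has another form. *)
pose rho g := xget (0 : K) [set t | R g t].
have rhoE (g : rs_hom (Spec L) X) t : (forall q, range U (g q)) -> R g t -> rho g = t.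
  move=> gU Rt; have := xgetPex (0 : K) (ex_intro _ t Rt : exists t, [set t | R g t] t).
  move=> /(reads_inj gU Rt)/addrI/eqP.
  by rewrite -subr_eq0 -scalerBl scaler_eq0 (negbTE al0) orbF subr_eq0 => /eqP.
move=> /(finite_image rho)/finite_seqP[T TE].
(* Avoiding [T] contradicts finiteness; avoiding [0] makes the point new. *)
have [t] := large_restriction Klarge al fa Ja (0 :: T).
rewrite inE negb_or => /andP[t0 tT] [v fv vj0].
have [|psi psiE] := rmorph_factor (pi := mmap iota y) (g := mmap (in_alg L) v) gen.
  move=> P /ker[g ->]; rewrite rmorph_sum big1 // => i _.
  by rewrite rmorphM /= fv mulr0.
have psiK k : psi (iota k) = k%:A by rewrite -(mmapC y iota) psiE /= mmapC.
have psiy : psi (y j0) = (a j0)%:A + t *: al by rewrite -vj0 -(mmapXU iota y) psiE /= mmapXU.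
pose ht := rs_comp U (Spec_map psi).
have htU q : range U (ht q) by exists (Spec_map psi q).
have Rt : R ht t by rewrite /R -psiy; apply: reads_comp; apply: reads_chart.
suff htN : new_points X L ht.
  case/negP: tT; suff : [set` T] t by [].
  by rewrite -TE; exists ht => //; apply: rhoE.
split.
  rewrite /points /= /ht rs_compA (chart_over U); exact: Spec_map_comp.
move=> [F /eqP FL [g gK htg]]; apply: FL; apply: alF.
have gU q : range U (g q).
  rewrite (spec_field_pt q) -(spec_field_pt (Spec_map (vsval : subvs_of F -> L) (field_pt L))).
  have := htU (field_pt L); rewrite htg; exact.
have [w wE] := ex_reads Uo gU.
(* If the point came from [F], its coordinate [j0] would lie in [F], and with it [al], since [t] is
   invertible. *)
have tal : (a j0)%:A + t *: al = vsval (w (y j0)).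
  apply: (reads_inj htU Rt); rewrite htg; exact: reads_comp.
have -> : al = t^-1 *: (vsval (w (y j0)) - (a j0)%:A).
  by rewrite -tal addrC addKr scalerA mulVf // scale1r.
by rewrite rpredZ // rpredB ?subvsP // rpredZ // rpred1.
Qed.
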